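(* Let $m$ be a positive integer, and let $\mathcal{C}_m$ and $\mathcal{D}_m$ be the Shi arrangements of type C and type D. (1) Fix $H\in\mathcal{C}_m$. Then the characteristic quasi-polynomial of $\mathcal{C}_m\setminus\{H\}$ is a polynomial if and only if $H$ is one of the following: - $H=\{x_i-x_j=0\}$ for some $1\leq i<j\leq m$; - $H=\{x_i-x_j=1\}$ for some $1\leq i<j\leq m$. (2) Fix $H\in\mathcal{D}_m$. Then the characteristic quasi-polynomial of $\mathcal{D}_m\setminus\{H\}$ is a polynomial if and only if $H$ is one of the following: - $H=\{x_i-x_{m+1-i}=0\}$ for some $1\leq i\leq m$; - $H=\{x_i-x_j=1\}$ for some $1\leq i<j\leq m$; - $H=\{x_1+x_j=0\}$ for some $2\leq j\leq m$; - $H=\{x_i+x_m=1\}$ for some $1\leq i\leq m-1$.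
   Context: For $q\in\mathbb{Z}_{>0}$ put $\mathbb{Z}_q=\mathbb{Z}/q\mathbb{Z}$. A hyperplane $H$ given by an integral equation $a_1x_1+\cdots+a_mx_m=b$ ($a_k,b\in\mathbb{Z}$) defines $H[q]=\{x\in\mathbb{Z}_q^m \mid a_1x_1+\cdots+a_mx_m= b \text{ in } \mathbb{Z}_q\}$, using the equation exactly as written (so $\{2x_i=0\}$ is not replaced by $\{x_i=0\}$). For a finite set $\mathcal{A}$ of such hyperplanes, $M(\mathcal{A}_q)=\mathbb{Z}_q^m\setminus\bigcup_{H\in\mathcal{A}}H[q]$. It is known (Kamiya–Takemura–Terao) that for all sufficiently large $q$ the number $|M(\mathcal{A}_q)|$ is given by a quasi-polynomial in $q$ (there are $\rho\ge1$ and polynomials $f_1,\dots,f_\rho$ with $|M(\mathcal{A}_q)|=f_r(q)$ whenever $q\equiv r \bmod \rho$), called the characteristic quasi-polynomial of $\mathcal{A}$. It is a polynomial if there is a single polynomial $f$ with $|M(\mathcal{A}_q)|=f(q)$ for all sufficiently large $q$. The arrangements are $\mathcal{C}_m=\{\{2x_i=0\},\{2x_i=1\}\mid 1\le i\le m\}\cup\{\{x_i\pm x_j=0\},\{x_i\pm x_j=1\}\mid 1\leq i<j\leq m\}$ and $\mathcal{D}_m=\{\{x_i\pm x_j=0\},\{x_i\pm x_j=1\}\mid 1\leq i<j\leq m\}$. Two equations defining the same hyperplane up to sign, such as $x_i-x_j=0$ and $x_j-x_i=0$, denote the same element. *)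

(* Defs.v *)
From mathcomp Require Import all_boot all_order all_algebra.
From mathcomp Require Import generic_quotient finmap.

Set Implicit Arguments.
Unset Strict Implicit.
Unset Printing Implicit Defensive.

Import GRing.Theory.
Local Open Scope ring_scope.
Local Open Scope quotient_scope.

(* (a, b) stands for the equation a_1 x_1 + ... + a_m x_m = b, as written. *)
Definition equation (m : nat) : Type := ('rV[int]_m * int)%type.

Definition eq_upto_sign (m : nat) : rel (equation m) :=
  fun e f => (e == f) || (e == - f).

Lemma eq_upto_sign_equiv (m : nat) : equiv_class_of (@eq_upto_sign m).
Proof.
have sym : symmetric (@eq_upto_sign m).
  by move=> e f; rewrite /eq_upto_sign eq_sym -eqr_oppLR [- e == f]eq_sym.
split=> // [e | f e g]; first by rewrite /eq_upto_sign eqxx.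
rewrite /eq_upto_sign => /orP[] /eqP-> /orP[] /eqP->;
  by rewrite ?opprK eqxx ?orbT.
Qed.

Canonical eq_upto_sign_equivRel (m : nat) := EquivRelPack (@eq_upto_sign_equiv m).

(* Only the global sign of an equation is forgotten, so 2 x_i = 0 and x_i = 0
   still denote different elements. *)
Definition hyperplane (m : nat) : Type := {eq_quot @eq_upto_sign m}.

Definition hyp (m : nat) (a : 'rV[int]_m) (b : int) : hyperplane m :=
  \pi_(hyperplane m) ((a, b) : equation m).

Definition xcoord (m : nat) (i : 'I_m) : 'rV[int]_m := delta_mx 0 i.

Definition equation_mod (m : nat) (e : equation m) (q : nat) :
    {set 'rV['Z_q]_m} :=
  [set x : 'rV['Z_q]_m | \sum_(k < m) (e.1 0 k)%:~R * x 0 k == e.2%:~R].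

Definition hyperplane_mod (m : nat) (H : hyperplane m) (q : nat) :
    {set 'rV['Z_q]_m} :=
  equation_mod (repr H) q.

Lemma equation_modN (m : nat) (e : equation m) (q : nat) :
  equation_mod (- e) q = equation_mod e q.
Proof.
apply/setP=> x; rewrite !inE /=.
under eq_bigr do rewrite mxE rmorphN mulNr.
by rewrite sumrN rmorphN eqr_opp.
Qed.

Lemma hyperplane_mod_hyp (m : nat) (a : 'rV[int]_m) (b : int) (q : nat) :
  hyperplane_mod (hyp a b) q = equation_mod (a, b) q.
Proof.
rewrite /hyperplane_mod /hyp; case: piP => e /eqP.
by rewrite eqmodE => /orP[] /eqP->; rewrite ?equation_modN.
Qed.

Definition arr_complement (m : nat) (A : {fset hyperplane m}) (q : nat) :
    {set 'rV['Z_q]_m} :=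
  ~: (\bigcup_(H <- A) hyperplane_mod H q)%SET.

(* The guard 1 < q is there because 'Z_1 is not the trivial ring Z/1Z. *)
Definition char_quasipoly_is_polynomial (m : nat) (A : {fset hyperplane m}) :
    Prop :=
  exists f : {poly rat}, exists q0 : nat, forall q : nat,
    (1 < q)%N -> (q0 <= q)%N -> #|arr_complement A q|%:R = f.[q%:R].

Local Open Scope fset_scope.

Definition shiD (m : nat) : {fset hyperplane m} :=
  \bigcup_(i in 'I_m) \bigcup_(j in 'I_m | (i < j)%N)
    [fset hyp (xcoord i + xcoord j) 0; hyp (xcoord i + xcoord j) 1;
          hyp (xcoord i - xcoord j) 0; hyp (xcoord i - xcoord j) 1].

Definition shiC (m : nat) : {fset hyperplane m} :=
  (\bigcup_(i in 'I_m) [fset hyp (2 *: xcoord i) 0; hyp (2 *: xcoord i) 1])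
  `|` shiD m.

(* Main.v *)
Require Import Defs.
From Stdlib Require Import FunctionalExtensionality.
From mathcomp Require Import all_boot all_order all_algebra.
From mathcomp Require Import generic_quotient finmap.
From mathcomp Require Import zify ring lra.

(** Deleting a hyperplane H from an arrangement adds to the complement modulo q
    exactly the new points, those that lie on H and on no other member
    ([card_deletion]). For large q of either parity the full complements have
    (q - 2m)^m points in type C and (q + 2 - 2m)^m points in type D, so the
    deletion has a polynomial count if and only if the new points do. Their
    number is computed exactly: it is one polynomial in q for even q and one
    for odd q, and the theorem says when the two coincide.

    Coordinates are lifted to the integers y_i nearest to 0, and label i is put
    in the cell `|y_i| together with the sign of y_i. Order the signed labels by
    1 < ... < m < -m < ... < -1, where the sign of 0 counts as negative. Then
    avoiding the type D hyperplanes modulo q means that the labels lie in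
    distinct cells and that labels in consecutive cells increase ([no_hitP],
    [word_pair_ok]); the parity of q survives only in the shape of the box
    [-A, B] of the y_i, with B = A or B = A + 1. Type C moreover excludes the
    value 0 and shrinks the box. Every maximal run of labels in consecutive
    cells is thus sorted, so that a word is known once one knows, for each label,
    its sign and the number of empty cells before it. This is a bijection from
    words onto all functions to a smaller interval ([squeeze] and [spread]), and
    the full counts follow.

    At a new point of x_i +- x_j = 0 the labels i and j share a cell, and at a
    new point of x_i +- x_j = 1 they lie in consecutive cells in decreasing
    order. One more cell inserted between them ([stretch]) gives a genuine word
    in which no label lies between i and j; in the code of that word, i and j
    are neighbours in the lexicographic order by number of empty cells and
    signed label. Once the codes of i and j are chosen, every other label
    has only to avoid at most three values, which depend on its position with
    respect to i and j. So each count is a sum of products over the other labels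
    ([codes_equal_pos] and the lemmas after it). In type D the points where i or j
    sits at a fixed point 0 or q/2 of x -> -x or at (q +- 1)/2 may lie on
    a second hyperplane of the pair; these are subtracted. The parity of q enters
    through them and through the shape of the box ([words_only_hitD],
    [words_only_hitC]).

    The even and the odd polynomials are compared by their values at 2 or 3
    ([new_polyD_parity], [new_polyC_parity]). For 2 x_i = 0 and 2 x_i = 1 it is
    enough that q/2, respectively (q + 1)/2, is a residue for one parity only
    ([deletion_diag_not_polynomial]). *)

Set Implicit Arguments.
Unset Strict Implicit.
Unset Printing Implicit Defensive.

Import Order.TTheory GRing.Theory Num.Theory.
Local Open Scope ring_scope.

(** * Counting through lists *)

(** The sets counted below are finite but live in the infinite type of integer
    vectors, so that no bound has to be carried along when cells are inserted
    or removed. *)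
Definition counted (T : eqType) (P : T -> Prop) (n : nat) : Prop :=
  exists s : seq T, [/\ uniq s, forall x, x \in s <-> P x & size s = n].

Lemma counted_card (T : finType) (A : {set T}) n :
  counted (fun x => x \in A) n -> #|A| = n.
Proof.
case=> s [us sA <-]; rewrite -(card_uniqP us); apply: eq_card => x.
by apply/idP/idP => /sA.
Qed.

Lemma counted_ext (T : eqType) (P Q : T -> Prop) n :
  (forall x, P x <-> Q x) -> counted P n -> counted Q n.
Proof.
by move=> PQ [s [us sP sz]]; exists s; split=> // x; rewrite sP PQ.
Qed.

Lemma counted_bij (T T' : eqType) (P : T -> Prop) (Q : T' -> Prop)
    (f : T -> T') (h : T' -> T) n :
    (forall x, P x -> Q (f x) /\ h (f x) = x) ->
    (forall y, Q y -> P (h y) /\ f (h y) = y) ->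
  counted P n -> counted Q n.
Proof.
move=> fP hQ [s [us sP sz]]; exists (map f s); split.
- rewrite map_inj_in_uniq // => x y /sP/fP[_ hx] /sP/fP[_ hy] fxy.
  by rewrite -hx fxy hy.
- move=> y; split; first by case/mapP=> x /sP/fP[Qfx _] ->.
  by case/hQ=> Px <-; apply: map_f; apply/sP.
- by rewrite size_map.
Qed.

Lemma counted_or (T : eqType) (P Q : T -> Prop) n k :
    (forall x, P x -> Q x -> False) ->
  counted P n -> counted Q k -> counted (fun x => P x \/ Q x) (n + k).
Proof.
move=> PQ [s [us sP <-]] [t [ut tQ <-]]; exists (s ++ t); split.
- rewrite cat_uniq us ut andbT /=; apply/hasPn=> x /tQ Qx.
  by apply/negP=> /sP Px; apply: PQ Px Qx.
- by move=> x; rewrite mem_cat -sP -tQ; split=> /orP.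
- by rewrite size_cat.
Qed.

Lemma counted_diff (T : eqType) (P Q : T -> Prop) n k :
    (forall x, Q x -> P x) -> counted P n -> counted Q k ->
  (k <= n)%N /\ counted (fun x => P x /\ ~ Q x) (n - k).
Proof.
move=> QP [s [us sP <-]] [t [ut tQ <-]].
have eqt : size t = count [in t] s.
  rewrite -size_filter; apply/perm_size/uniq_perm; rewrite ?filter_uniq // => x.
  rewrite mem_filter; case: (boolP (x \in t)) => //= /tQ/QP/sP -> //.
rewrite eqt count_size; split=> //.
exists [seq x <- s | x \notin t]; split; first by rewrite filter_uniq.
  by move=> x; rewrite mem_filter -sP -tQ; split=> [/andP[/negP]|[? /negP ->]].
by rewrite size_filter -(count_predC [in t] s) addKn.
Qed.

Lemma counted_none (T : eqType) (P : T -> Prop) :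
  (forall x, ~ P x) -> counted P 0.
Proof. by move=> nP; exists [::]; split=> // x; split=> // /nP. Qed.

Lemma counted_fibers (T V : eqType) (P : T -> Prop) (p : T -> V) (s : seq V) n :
    uniq s -> (forall x, P x -> p x \in s) ->
    (forall v, v \in s -> counted (fun x => P x /\ p x = v) n) ->
  counted P (size s * n).
Proof.
elim: s P => [|v s IH] P /=; first by move=> _ Pn _; apply: counted_none=> x /Pn.
case/andP=> v's us Ps cP; rewrite mulSn.
have cs : counted (fun x => P x /\ p x \in s) (size s * n).
  apply: IH => // [x [] //|w sw].
  apply: counted_ext (cP w _); last by rewrite inE sw orbT.
  by move=> x; split=> [[Px e]|[[Px _] e]]; do ?split=> //; rewrite e.
have cv : counted (fun x => P x /\ p x = v) n by apply: cP; rewrite mem_head.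
have disj x : P x /\ p x = v -> P x /\ p x \in s -> False.
  by move=> [_ ->] [_]; rewrite (negPf v's).
apply: counted_ext (counted_or disj cv cs) => x.
split=> [[[]|[]] //|Px].
by have := Ps x Px; rewrite inE => /orP[/eqP|]; [left|right].
Qed.

Lemma counted_family (I : finType) (A : I -> seq int) :
    (forall i, uniq (A i)) ->
  counted (fun g : {ffun I -> int} => forall i, g i \in A i)
    (\prod_i size (A i))%N.
Proof.
move=> uA.
pose M := \max_i size (A i).
have szM i : (size (A i) <= M)%N by apply: leq_bigmax.
pose F := family (fun i => [pred k : 'I_M.+1 | k < size (A i)]%N).
have cF : counted (fun f => f \in F) (\prod_i size (A i))%N.
  exists (enum F); split; [exact: enum_uniq|by move=> f; rewrite mem_enum|].
  rewrite -cardE card_family foldrE big_map big_enum; apply: eq_bigr => i _.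
  have le1 : (size (A i) <= M.+1)%N by apply: leq_trans (szM i) _.
  have inj : injective (widen_ord le1) by move=> x y /(congr1 val) /= /val_inj.
  rewrite -[RHS]card_ord -(card_codom inj).
  apply: eq_card => k; rewrite inE; apply/idP/codomP => [lt|[j ->]] //=.
  by exists (Ordinal lt); apply: val_inj.
apply: (counted_bij
  (f := fun f : {ffun I -> 'I_M.+1} => [ffun i => nth 0 (A i) (f i)])
  (h := fun g => [ffun i => inord (index (g i) (A i))])) cF => [f /familyP fF|g gA].
  split=> [i|]; first by rewrite ffunE mem_nth //; apply: fF.
  by apply/ffunP=> i; rewrite !ffunE index_uniq ?inord_val //; apply: fF.
have idx i : @inord M (index (g i) (A i)) = index (g i) (A i) :> nat.
  by rewrite inordK // ltnS; exact: leq_trans (index_size _ _) (szM i).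
split; first by apply/familyP=> i; rewrite inE /= ffunE idx index_mem.
by apply/ffunP=> i; rewrite !ffunE idx nth_index.
Qed.

(** * Words of signed labels and their codes *)

Definition outward (s : bool) (c : nat) : int := if s then c%:Z else - c%:Z.

(** The position of a signed label in the order 1 < ... < m < -m < ... < -1. *)
Definition key (m : nat) (s : bool) (i : 'I_m) : nat :=
  if s then i : nat else (m + m - i)%N.

Definition skey (m : nat) (u : 'I_m -> int) (i : 'I_m) : nat := key (0 < u i) i.

(** The lexicographic order by absolute value and signed label. For a word it
    is the order of the cells; for a code it is the order in which the labels
    occur in the word. *)
Definition prec (m : nat) (u : 'I_m -> int) (l i : 'I_m) : bool :=
  (`|u l| < `|u i|)%N || (`|u l|%N == `|u i|%N) && (skey u l < skey u i)%N.

Definition pair_ok (m : nat) (u : 'I_m -> int) (i j : 'I_m) : Prop :=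
  [/\ u i <> u j, u i + u j <> 0, u i - u j <> 1 & u i + u j <> 1].

Definition spaced (m : nat) (u : 'I_m -> int) (i l : 'I_m) : Prop :=
  `|u i|%N <> `|u l|%N /\ (`|u l|%N = `|u i|.+1 -> (skey u i < skey u l)%N).

Definition word (m : nat) (u : 'I_m -> int) : Prop :=
  forall i l, i <> l -> spaced u i l.

Definition inbox (m : nat) (a b : nat) (u : 'I_m -> int) : Prop :=
  forall i, - a%:Z <= u i <= b%:Z.

(** Two labels in consecutive cells decrease exactly when one of the equations
    x_i - x_j = 1 with i < j (equal signs) or x_i + x_j = 1 (a negative label
    before a positive one) holds. *)
Lemma pair_okP (m : nat) (u : 'I_m -> int) (i j : 'I_m) : (i < j)%N ->
  pair_ok u i j <-> spaced u i j /\ spaced u j i.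
Proof.
move=> ij; have := ltn_ord i; have := ltn_ord j; move: ij.
rewrite /pair_ok /spaced /skey /key; move: (u i) (u j) (nat_of_ord i) (nat_of_ord j).
move=> x y {}i {}j ij im jm; case: (ltrP 0 x); case: (ltrP 0 y) => y0 x0.
- split; [case=> *; do ?split; lia | case=> [] [] ? h1 [] ? h2; split; try lia].
- split; [case=> *; do ?split; lia | case=> [] [] ? h1 [] ? h2; split; try lia].
- split; [case=> *; do ?split; lia | case=> [] [] ? h1 [] ? h2; split; try lia].
- split; [case=> *; do ?split; lia | case=> [] [] ? h1 [] ? h2; split; try lia].
Qed.

Lemma word_pair_ok (m : nat) (u : 'I_m -> int) :
  word u <-> forall i j : 'I_m, (i < j)%N -> pair_ok u i j.
Proof.
split=> [w i j ij|ok i l il].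
  by apply/(pair_okP u ij); split; apply: w => e; rewrite e ltnn in ij.
have [ij|ji|/val_inj//] := ltngtP i l.
  by have /(pair_okP u ij)[] := ok _ _ ij.
by have /(pair_okP u ji)[] := ok _ _ ji.
Qed.

Lemma skey_inj (m : nat) (u : 'I_m -> int) i l : skey u i = skey u l -> i = l.
Proof.
have := ltn_ord i; have := ltn_ord l => im lm.
by rewrite /skey /key; case: ifP; case: ifP => _ _ e; apply: val_inj => /=; lia.
Qed.

Lemma skey_pos (m : nat) (u : 'I_m -> int) i : (0 < u i) = (skey u i < m)%N.
Proof. by have := ltn_ord i; rewrite /skey /key; case: ifP => _; lia. Qed.

Lemma prec_irr (m : nat) (u : 'I_m -> int) i : prec u i i = false.
Proof. by rewrite /prec !ltnn andbF. Qed.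

Lemma prec_trans (m : nat) (u : 'I_m -> int) i l k :
  prec u i l -> prec u l k -> prec u i k.
Proof. rewrite /prec; lia. Qed.

Lemma prec_total (m : nat) (u : 'I_m -> int) i l :
  i <> l -> prec u i l \/ prec u l i.
Proof.
move=> il; have : skey u i <> skey u l by move/skey_inj.
rewrite /prec; lia.
Qed.

Definition rank (m : nat) (u : 'I_m -> int) i : nat := #|[set l | prec u l i]|.

(** From a code to its word: `|u i| is the number of empty cells before label i,
    and the cells of the labels that precede i are added to it. *)
Definition spread (m : nat) (u : 'I_m -> int) (i : 'I_m) : int :=
  outward (0 < u i) (`|u i| + rank u i).

Lemma rank_lt (m : nat) (u : 'I_m -> int) i l :
  prec u l i -> (rank u l < rank u i)%N.
Proof.
move=> li; apply: proper_card; apply/properP; split.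
  by apply/subsetP=> k; rewrite !inE => kl; apply: prec_trans kl li.
by exists l; rewrite inE ?prec_irr.
Qed.

Lemma rank_max (m : nat) (u : 'I_m -> int) i : (rank u i < m)%N.
Proof.
rewrite -{2}[m]card_ord; apply: (@leq_trans #|[set: 'I_m]|); last by rewrite cardsT.
apply: proper_card; apply/properP; split; first exact: subsetT.
by exists i; rewrite !inE ?prec_irr.
Qed.

Lemma abs_spread (m : nat) (u : 'I_m -> int) i :
  `|spread u i|%N = (`|u i| + rank u i)%N.
Proof. by rewrite /spread /outward; case: ifP => _; lia. Qed.

Lemma spread_pos (m : nat) (u : 'I_m -> int) i : (0 < spread u i) = (0 < u i).
Proof. by rewrite /spread /outward; case: ifP => ui; lia. Qed.

Lemma skey_spread (m : nat) (u : 'I_m -> int) i : skey (spread u) i = skey u i.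
Proof. by rewrite /skey spread_pos. Qed.

Lemma prec_le (m : nat) (u : 'I_m -> int) i l : prec u l i -> (`|u l| <= `|u i|)%N.
Proof. by rewrite /prec; lia. Qed.

Lemma spread_lt (m : nat) (u : 'I_m -> int) i l :
  (`|spread u l| < `|spread u i|)%N = prec u l i.
Proof.
have mono a b : prec u a b -> (`|spread u a| < `|spread u b|)%N.
  move=> ab; have := rank_lt ab; have := prec_le ab; rewrite !abs_spread; lia.
apply/idP/idP => [lt|]; last exact: mono.
have [e|/eqP ne] := eqVneq l i; first by rewrite e ltnn in lt.
by case: (prec_total u ne) => // /mono; lia.
Qed.

(** Consecutive cells have consecutive ranks, hence equal `|u|, and then [prec]
    compares signed labels. *)
Lemma spread_word (m : nat) (u : 'I_m -> int) : word (spread u).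
Proof.
move=> i l il; split.
  by case: (prec_total u il); rewrite -spread_lt; lia.
move=> e; have il' : prec u i l by rewrite -spread_lt e.
rewrite !skey_spread; have := rank_lt il'; have := prec_le il'.
by move: e il'; rewrite !abs_spread /prec; lia.
Qed.

Definition below (m : nat) (y : 'I_m -> int) (t : nat) : nat :=
  #|[set l | `|y l| < t]%N|.

(** From a word to its code: occupied cells are not counted. *)
Definition squeeze (m : nat) (y : 'I_m -> int) (i : 'I_m) : int :=
  outward (0 < y i) (`|y i| - below y `|y i|)%N.

Lemma below0 (m : nat) (y : 'I_m -> int) : below y 0 = 0%N.
Proof. by rewrite /below; apply/eqP; rewrite cards_eq0; apply/eqP/setP=> l; rewrite !inE. Qed.

Lemma belowS_occ (m : nat) (y : 'I_m -> int) p t :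
  word y -> `|y p|%N = t -> below y t.+1 = (below y t).+1.
Proof.
move=> w yp; rewrite /below.
have -> : [set l | `|y l| < t.+1]%N = p |: [set l | `|y l| < t]%N.
  apply/setP=> l; rewrite !inE; have [->|/eqP lp] := eqVneq l p; first by rewrite yp ltnSn.
  have [] := w _ _ lp; rewrite yp /=; lia.
by rewrite cardsU1 inE yp ltnn.
Qed.

Lemma belowS_free (m : nat) (y : 'I_m -> int) t :
  (forall p, `|y p|%N <> t) -> below y t.+1 = below y t.
Proof.
by move=> yt; apply: eq_card => l; rewrite !inE; have := yt l; lia.
Qed.

Lemma below_le (m : nat) (y : 'I_m -> int) t : word y -> (below y t <= t)%N.
Proof.
move=> w; elim: t => [|t IH]; first by rewrite below0.
case: (pickP (fun p => `|y p| == t)%N) => [p /eqP yp|yt].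
  by rewrite (belowS_occ w yp); lia.
by rewrite belowS_free; [lia|move=> p /eqP; rewrite yt].
Qed.

Definition empties (m : nat) (y : 'I_m -> int) (t : nat) : nat := (t - below y t)%N.

Lemma emptiesS_occ (m : nat) (y : 'I_m -> int) p t :
  word y -> `|y p|%N = t -> empties y t.+1 = empties y t.
Proof.
by move=> w yp; rewrite /empties (belowS_occ w yp) subSS.
Qed.

Lemma emptiesS_free (m : nat) (y : 'I_m -> int) t :
  word y -> (forall p, `|y p|%N <> t) -> empties y t.+1 = (empties y t).+1.
Proof.
by move=> w yt; have := below_le t w; rewrite /empties (belowS_free yt); lia.
Qed.

Lemma occupied_dec (m : nat) (y : 'I_m -> int) t :
  {p | `|y p|%N = t} + (forall p, `|y p|%N <> t).
Proof.
case: (pickP (fun p => `|y p| == t)%N) => [p /eqP yp|yt]; first by left; exists p.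
by right=> p /eqP; rewrite yt.
Qed.

Lemma empties_leS (m : nat) (y : 'I_m -> int) t :
  word y -> (empties y t <= empties y t.+1)%N.
Proof.
move=> w; case: (occupied_dec y t) => [[p yp]|yt].
  by rewrite (emptiesS_occ w yp).
by rewrite emptiesS_free.
Qed.

Lemma empties_le (m : nat) (y : 'I_m -> int) t t' :
  word y -> (t <= t')%N -> (empties y t <= empties y t')%N.
Proof.
move=> w /subnK <-; elim: (t' - t)%N => // k IH.
by rewrite addSn; apply: leq_trans IH (empties_leS _ w).
Qed.

(** Labels with no empty cell between them belong to one run, and runs are
    increasing. *)
Lemma same_block (m : nat) (y : 'I_m -> int) l i :
  word y -> (`|y l| < `|y i|)%N -> empties y `|y i| = empties y `|y l| ->
  (skey y l < skey y i)%N.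
Proof.
move=> w; move eqt : `|y i|%N => t; elim: t i eqt => // t IH i yi lt e.
have [eq_t|lt_t] : `|y l|%N = t \/ (`|y l| < t)%N by lia.
  have li : l <> i by move=> h; rewrite h yi in eq_t; lia.
  by have [_] := w _ _ li; apply; rewrite yi eq_t.
have := empties_le w (ltnW lt_t); have := empties_leS t w.
case: (occupied_dec y t) => [[p yp]|yt]; last by rewrite emptiesS_free // in e *; lia.
rewrite (emptiesS_occ w yp) in e * => _ _.
have lp := IH _ yp lt_t e.
have pi : p <> i by move=> h; rewrite h yi in yp; lia.
by have [_] := w _ _ pi; rewrite yi yp => /(_ erefl); lia.
Qed.

(** The label in cell 0 is nonpositive, hence so is the whole run that starts
    there. This is why the code 0 carries a sign and codes are plain integers. *)
Lemma first_block (m : nat) (y : 'I_m -> int) i :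
  word y -> empties y `|y i| = 0%N -> y i <= 0 /\ exists p, y p = 0.
Proof.
move=> w e0.
have [p yp] : exists p, y p = 0.
  have [|lt0] := posnP `|y i|%N; first by exists i; lia.
  have := empties_le w lt0; rewrite e0 => e1.
  case: (occupied_dec y 0) => [[p yp]|y0]; first by exists p; lia.
  by rewrite (emptiesS_free w y0) in e1.
split; last by exists p.
have [|lt0] := posnP `|y i|%N; first lia.
have : (skey y p < skey y i)%N.
  by apply: same_block => //; rewrite yp // e0 /empties below0.
by rewrite leNgt skey_pos /skey yp ltxx /key; have := ltn_ord p; lia.
Qed.

Lemma abs_squeeze (m : nat) (y : 'I_m -> int) i :
  `|squeeze y i|%N = empties y `|y i|.
Proof. by rewrite /squeeze /outward -/(empties _ _); case: ifP => _; lia. Qed.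

(** A positive label is never in the run of cell 0, so its code is positive. *)
Lemma squeeze_pos (m : nat) (y : 'I_m -> int) i :
  word y -> (0 < squeeze y i) = (0 < y i).
Proof.
move=> w; rewrite /squeeze /outward -/(empties _ _); case: ifP => yi; last by lia.
have [e|//] := posnP (empties y `|y i|); have := first_block w e; lia.
Qed.

Lemma skey_squeeze (m : nat) (y : 'I_m -> int) i :
  word y -> skey (squeeze y) i = skey y i.
Proof. by move=> w; rewrite /skey squeeze_pos. Qed.

Lemma squeeze_prec (m : nat) (y : 'I_m -> int) i l :
  word y -> prec (squeeze y) l i = (`|y l| < `|y i|)%N.
Proof.
move=> w.
have mono a b : (`|y a| < `|y b|)%N -> prec (squeeze y) a b.
  move=> ab; rewrite /prec !abs_squeeze !skey_squeeze //.
  have := empties_le w (ltnW ab); rewrite leq_eqVlt => /orP[/eqP e|->//].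
  by rewrite e eqxx same_block ?orbT.
apply/idP/idP => [lt|]; last exact: mono.
have [e|/eqP li] := eqVneq l i; first by rewrite e prec_irr in lt.
have [ne _] := w _ _ li.
have [//|gt] : (`|y l| < `|y i|)%N \/ (`|y i| < `|y l|)%N by lia.
by have := prec_trans lt (mono _ _ gt); rewrite prec_irr.
Qed.

Lemma squeezeK (m : nat) (y : 'I_m -> int) : word y -> spread (squeeze y) =1 y.
Proof.
move=> w i; rewrite /spread squeeze_pos // abs_squeeze.
have -> : rank (squeeze y) i = below y `|y i|.
  by apply: eq_card => l; rewrite !inE squeeze_prec.
by rewrite /empties /outward; have := below_le `|y i| w; case: ifP => yi; lia.
Qed.

Lemma spreadK (m : nat) (u : 'I_m -> int) : squeeze (spread u) =1 u.
Proof.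
move=> i; rewrite /squeeze spread_pos abs_spread.
have -> : below (spread u) (`|u i| + rank u i) = rank u i.
  by apply: eq_card => l; rewrite !inE -abs_spread spread_lt.
by rewrite addnK /outward; case: ifP => ui; lia.
Qed.

Lemma spread_box (m : nat) (a b : nat) (u : 'I_m -> int) :
  inbox a b u -> inbox (a + m.-1) (b + m.-1) (spread u).
Proof.
move=> ub i; have := ub i; have := rank_max u i.
by rewrite /spread /outward; case: ifP => ui; lia.
Qed.

Lemma empties_all (m : nat) (y : 'I_m -> int) t :
  (forall i, `|y i| < t)%N -> empties y t = (t - m)%N.
Proof.
move=> yt; rewrite /empties /below (_ : [set l | _] = setT) ?cardsT ?card_ord //.
by apply/setP=> l; rewrite !inE yt.
Qed.

(** All m labels lie in the cells up to b + m - 1, so at most b cells among them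
    are empty. If the box is longer on the positive side, a nonpositive label
    preceded by b empty cells would be in one run with a positive label in the
    last cell, and come before it; so at most a = b - 1 empty cells precede it. *)
Lemma squeeze_box (m : nat) (a b : nat) (y : 'I_m -> int) :
    (a <= b <= a.+1)%N -> word y ->
  inbox (a + m.-1) (b + m.-1) y -> inbox a b (squeeze y).
Proof.
move=> ab w yb i; have im := ltn_ord i; have ybi := yb i.
have all_lt : forall l, (`|y l| < (b + m.-1).+1)%N by move=> l; have := yb l; lia.
have eb := empties_all all_lt.
have lei : (empties y `|y i| <= b)%N.
  have : (empties y `|y i| <= empties y (b + m.-1).+1)%N by apply: empties_le => //; lia.
  by rewrite eb; lia.
have [ea|bS] : b = a \/ b = a.+1 by lia.
  by rewrite /squeeze /outward -/(empties _ _); case: ifP => _; lia.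
rewrite /squeeze /outward -/(empties _ _); case: ifP => yi; first lia.
suff : (empties y `|y i| <= a)%N by lia.
have le1 : (empties y `|y i| <= empties y (b + m.-1))%N by apply: empties_le => //; lia.
case: (occupied_dec y (b + m.-1)) => [[p yp]|yt]; last first.
  by have := emptiesS_free w yt; lia.
have eS := emptiesS_occ w yp; have ybp := yb p.
have : empties y `|y i| <> empties y `|y p|.
  move=> e; have lt : (`|y i| < `|y p|)%N by lia.
  have := same_block w lt (esym e).
  have: (skey y p < m)%N by rewrite -skey_pos; lia.
  have: ~~ (skey y i < m)%N by rewrite -skey_pos yi.
  lia.
by rewrite yp; lia.
Qed.

Lemma squeeze_zero (m : nat) (y : 'I_m -> int) :
  word y -> (exists i, squeeze y i = 0) <-> (exists i, y i = 0).
Proof.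
move=> w; split=> [[i e]|[i e]].
  have := abs_squeeze y i; rewrite e => /esym /(first_block w) [_ [p]]; by exists p.
by exists i; have := abs_squeeze y i; rewrite e /empties; lia.
Qed.

(** * Inserting a cell between two labels *)

Lemma abs_outward (s : bool) (c : nat) : `|outward s c|%N = c.
Proof. by rewrite /outward; case: s; lia. Qed.

Lemma outward_abs (x : int) : outward (0 < x) `|x|%N = x.
Proof. by rewrite /outward; case: ifP; lia. Qed.

Lemma outward_pos (s : bool) (c : nat) : (s -> 0 < c)%N -> (0 < outward s c) = s.
Proof. by rewrite /outward; case: s => [/(_ isT)|_]; lia. Qed.

Definition word_but (m : nat) (a b : 'I_m) (y : 'I_m -> int) : Prop :=
  forall i l, i <> l -> ~ (i = a /\ l = b) -> ~ (i = b /\ l = a) -> spaced y i l.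

(** Label b is in the cell of a if d = 0, and in the next cell if d = 1. *)
Record touching (m : nat) (a b : 'I_m) (sa sb : bool) (d A B : nat)
    (y : 'I_m -> int) : Prop := Touching {
  touching_box : inbox A B y;
  touching_word : word_but a b y;
  touching_pos1 : (0 < y a) = sa;
  touching_pos2 : (0 < y b) = sb;
  touching_dist : `|y b|%N = (`|y a| + d)%N }.

(** What becomes of [touching] when one cell is inserted between a and b. *)
Record neighbours (m : nat) (a b : 'I_m) (sa sb : bool) (d A B : nat)
    (y : 'I_m -> int) : Prop := Neighbours {
  neighbours_box : inbox A B y;
  neighbours_word : word y;
  neighbours_pos1 : (0 < y a) = sa;
  neighbours_pos2 : (0 < y b) = sb;
  neighbours_dist : `|y b|%N = (`|y a| + d.+1)%N;
  neighbours_gap : forall l, ~~ (`|y a| < `|y l| < `|y b|)%N }.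

(** Label b and all labels beyond the cell of a move outward by one cell. *)
Definition stretch (m : nat) (a b : 'I_m) (y : 'I_m -> int) (l : 'I_m) : int :=
  outward (0 < y l) (`|y l| + ((l == b) || (`|y a| < `|y l|)%N)).

Definition unstretch (m : nat) (a : 'I_m) (y : 'I_m -> int) (l : 'I_m) : int :=
  outward (0 < y l) (`|y l| - (`|y a| < `|y l|)%N).

Lemma abs_stretch (m : nat) (a b : 'I_m) (y : 'I_m -> int) l :
  `|stretch a b y l|%N = (`|y l| + ((l == b) || (`|y a| < `|y l|)%N))%N.
Proof. exact: abs_outward. Qed.

Lemma stretch_pos (m : nat) (a b : 'I_m) (y : 'I_m -> int) l :
  (0 < stretch a b y l) = (0 < y l).
Proof. by rewrite /stretch outward_pos //; lia. Qed.

Lemma skey_stretch (m : nat) (a b : 'I_m) (y : 'I_m -> int) l :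
  skey (stretch a b y) l = skey y l.
Proof. by rewrite /skey stretch_pos. Qed.

Lemma abs_unstretch (m : nat) (a : 'I_m) (y : 'I_m -> int) l :
  `|unstretch a y l|%N = (`|y l| - (`|y a| < `|y l|))%N.
Proof. exact: abs_outward. Qed.

Section Stretch.
Variables (m : nat) (a b : 'I_m) (sa sb : bool) (d A B : nat).
Hypothesis ab : a <> b.
Hypothesis d_le1 : (d <= 1)%N.
Hypothesis d0 : d = 0%N -> (key sa a < key sb b)%N.
Hypothesis AB : (A <= B <= A.+1)%N.

(** For d = 0 the labels a and b end up in consecutive cells, which requires that
    a comes first in the order of signed labels. For d = 1 they end up with an
    empty cell between them, and their order does not matter. *)
Lemma stretch_neighbours (y : 'I_m -> int) :
  touching a b sa sb d A B y -> neighbours a b sa sb d A.+1 B.+1 (stretch a b y).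
Proof.
case=> yB w ya yb dist.
have far l : l <> a -> l <> b ->
  (spaced y a l /\ spaced y l a) /\ (spaced y b l /\ spaced y l b).
  by move=> la lb; split; split; apply: w; intuition congruence.
have ska : skey y a = key sa a by rewrite /skey ya.
have skb : skey y b = key sb b by rewrite /skey yb.
have ba : (b == a) = false by apply/eqP => e; apply: ab.
have abF : (a == b) = false by apply/eqP.
split.
- move=> l; have := yB l; rewrite /stretch /outward; case: ifP => yl; lia.
- move=> i l il; rewrite /spaced !skey_stretch !abs_stretch.
  have [eia|/eqP ia] := eqVneq i a.
    have [elb|/eqP lb] := eqVneq l b.
      by subst i l; rewrite !abF ska skb; lia.
    have la : l <> a by move=> e; apply: il; rewrite eia e.
    have := far l la lb; rewrite /spaced eia abF ska skb; lia.
  have [eib|/eqP ib] := eqVneq i b.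
    have [ela|/eqP la] := eqVneq l a.
      by subst i l; rewrite !abF; lia.
    have lb : l <> b by move=> e; apply: il; rewrite eib e.
    have := far l la lb; rewrite /spaced eib ?eqxx ska skb; lia.
  have := far i ia ib.
  have [ela|/eqP la] := eqVneq l a.
    by rewrite ela abF /spaced ska skb; lia.
  have [elb|/eqP lb] := eqVneq l b.
    by rewrite elb /spaced ska skb; lia.
  have sil : spaced y i l by apply: w => // -[].
  move=> _; move: sil; rewrite /spaced !orFb.
  by case: (ltnP `|y a| `|y i|) => hi; case: (ltnP `|y a| `|y l|) => hl [];
    rewrite ?addn1 ?addn0 => ? c; split; lia.
- by rewrite stretch_pos.
- by rewrite stretch_pos.
- by rewrite !abs_stretch eqxx abF ltnn; lia.
- move=> l; rewrite !abs_stretch eqxx abF ltnn.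
  have [elb|/eqP lb] := eqVneq l b; first by rewrite elb; lia.
  have [ela|/eqP la] := eqVneq l a; first by rewrite ela; lia.
  by have := far l la lb; rewrite /spaced; lia.
Qed.

Lemma stretchK (y : 'I_m -> int) :
  touching a b sa sb d A B y -> unstretch a (stretch a b y) =1 y.
Proof.
case=> yB w ya yb dist l; rewrite /unstretch stretch_pos !abs_stretch.
have abF : (a == b) = false by apply/eqP.
rewrite abF ltnn -[RHS]outward_abs; congr outward.
by have [elb|/eqP lb] := eqVneq l b; [rewrite elb; lia|lia].
Qed.

Lemma unstretch_pos (y : 'I_m -> int) l : neighbours a b sa sb d A.+1 B.+1 y ->
  (0 < unstretch a y l) = (0 < y l).
Proof.
case=> yB w ya yb dist gap; apply: outward_pos => yl.
have [elb|/eqP lb] := eqVneq l b.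
  rewrite elb in yl *; move: d0; rewrite -ya -yb yl /key => k0.
  have := ltn_ord b; have := ltn_ord a; move: k0 dist d_le1 yl.
  by clear; case: ltrP; lia.
move: (w _ _ lb) (gap l) dist yl; rewrite /spaced.
have [->|/eqP la] := eqVneq l a; first by lia.
by case: (w _ _ la); clear; lia.
Qed.

Lemma unstretchK (y : 'I_m -> int) :
  neighbours a b sa sb d A.+1 B.+1 y -> stretch a b (unstretch a y) =1 y.
Proof.
move=> N l; rewrite /stretch !unstretch_pos // !abs_unstretch -[RHS]outward_abs.
case: N => yB w ya yb dist gap.
congr outward; have := gap l; rewrite ltnn.
have [elb|/eqP lb] := eqVneq l b; first by rewrite elb; lia.
by have := w _ _ lb; rewrite /spaced; lia.
Qed.

Lemma unstretch_touching (y : 'I_m -> int) :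
  neighbours a b sa sb d A.+1 B.+1 y -> touching a b sa sb d A B (unstretch a y).
Proof.
move=> N; have pos l := unstretch_pos l N; have [yB w ya yb dist gap] := N.
have ska : skey y a = key sa a by rewrite /skey ya.
have skb : skey y b = key sb b by rewrite /skey yb.
split; rewrite ?pos //.
- move=> l; have yBl := yB l; have yBb := yB b.
  rewrite /unstretch /outward; case: ifP => yl; first by move: yBl yBb yl dist AB; clear; lia.
  have [ela|/eqP la] := eqVneq l a; last first.
    by have [nal _] := w _ _ la; move: yBl yBb yl nal dist AB; clear; lia.
  have yb0 : d = 0%N -> (0 < y b) = false.
    move=> /d0; have := ltn_ord a; have := ltn_ord b.
    rewrite -ya -yb -ela yl /key; clear.
    by case: ifP => //; lia.
  by move: yBl yBb yl dist AB yb0 d_le1; rewrite ela; clear; lia.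
- move=> i l il n1 n2; rewrite /spaced /skey !pos -!/(skey _ _) !abs_unstretch.
  have far k : k <> a -> k <> b ->
    (spaced y a k /\ spaced y k a) /\ (spaced y b k /\ spaced y k b).
    by move=> ka kb; split; split; apply: w; congruence.
  have wil := w _ _ il; have gi := gap i; have gl := gap l.
  rewrite /spaced.
  have [eia|/eqP ia] := eqVneq i a.
    have [elb|/eqP lb] := eqVneq l b; first by case: n1.
    have la : l <> a by move=> e; apply: il; rewrite eia e.
    have [[[nal fal] _] [[nbl fbl] _]] := far l la lb.
    rewrite eia ska ltnn; move: nal fal nbl fbl gl dist d_le1 d0; rewrite ska skb.
    by clear; lia.
  have [eib|/eqP ib] := eqVneq i b.
    have [ela|/eqP la] := eqVneq l a; first by case: n2.
    have lb : l <> b by move=> e; apply: il; rewrite eib e.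
    have [[[nal _] _] [[nbl fbl] _]] := far l la lb.
    by rewrite eib skb; move: nal nbl fbl gl dist d_le1; rewrite skb; clear; lia.
  have [[[nai fai] [_ fia]] [[nbi fbi] [_ fib]]] := far i ia ib.
  have [ela|/eqP la] := eqVneq l a.
    by rewrite ela ska ltnn; move: nai nbi fia gi dist d_le1; rewrite ska; clear; lia.
  have [elb|/eqP lb] := eqVneq l b.
    rewrite elb skb; move: nai nbi fia fib gi dist d_le1 d0; rewrite ska skb.
    by clear; lia.
  have [[[nal _] _] [[nbl _] _]] := far l la lb.
  move: wil nai nbi nal nbl gi gl dist; rewrite /spaced; clear.
  by case: (ltnP `|y a| `|y i|) => hi; case: (ltnP `|y a| `|y l|) => hl [] ? c *;
    split; lia.
- rewrite !abs_unstretch; lia.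
Qed.
End Stretch.

(** * Codes of words with a pair of neighbours *)

(** Words are counted as finite functions but studied as functions. *)
Lemma finfunE (m : nat) (f : 'I_m -> int) : finfun f = f :> ('I_m -> int).
Proof. by apply: functional_extensionality => i; rewrite ffunE. Qed.

(** A condition R on words may be counted on their codes. *)
Lemma counted_words (m a b : nat) (R R' : ('I_m -> int) -> Prop) n :
    (a <= b <= a.+1)%N ->
    (forall g, inbox a b g -> R (spread g) <-> R' g) ->
  counted (fun g : {ffun 'I_m -> int} => inbox a b g /\ R' g) n ->
  counted (fun y : {ffun 'I_m -> int} =>
    [/\ inbox (a + m.-1) (b + m.-1) y, word y & R y]) n.
Proof.
move=> ab RR'.
apply: (counted_bij (f := fun g : {ffun 'I_m -> int} => finfun (spread g))
  (h := fun y : {ffun 'I_m -> int} => finfun (squeeze y))).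
  move=> g [gb R'g]; rewrite !finfunE; split.
    by split; [apply: spread_box | apply: spread_word | apply/RR'].
  by apply/ffunP=> i; rewrite ffunE spreadK.
move=> y [yb w Ry]; rewrite !finfunE; have sb := squeeze_box ab w yb.
split; last by apply/ffunP=> i; rewrite ffunE squeezeK.
split=> //; apply/RR' => //.
by rewrite (functional_extensionality _ _ (squeezeK w)).
Qed.

(** What [neighbours] says about the code: a and b are adjacent in the order
    [prec], with d empty cells between them. *)
Record consecutive (m : nat) (a b : 'I_m) (sa sb : bool) (d al be : nat)
    (g : 'I_m -> int) : Prop := Consecutive {
  consecutive_box : inbox al be g;
  consecutive_pos1 : (0 < g a) = sa;
  consecutive_pos2 : (0 < g b) = sb;
  consecutive_dist : `|g b|%N = (`|g a| + d)%N;
  consecutive_prec : prec g a b;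
  consecutive_gap : forall l, ~~ (prec g a l && prec g l b) }.

Lemma rank_succ (m : nat) (g : 'I_m -> int) a b :
  prec g a b -> (forall l, ~~ (prec g a l && prec g l b)) ->
  rank g b = (rank g a).+1.
Proof.
move=> ab gap; rewrite /rank.
have -> : [set l | prec g l b] = a |: [set l | prec g l a].
  apply/setP=> l; rewrite !inE; apply/idP/orP => [lb|[/eqP->//|la]]; last first.
    exact: prec_trans la ab.
  have [->|/eqP la] := eqVneq l a; [by left|right].
  by case: (prec_total g la) => // al; have := gap l; rewrite al lb.
by rewrite cardsU1 inE prec_irr.
Qed.

Lemma rank_first (m : nat) (g : 'I_m -> int) a :
  rank g a = 0%N <-> forall l, ~~ prec g l a.
Proof.
split=> [/eqP|no]; last by apply/eqP; rewrite cards_eq0; apply/eqP/setP=> l; rewrite !inE (negPf (no l)).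
by rewrite cards_eq0 => /eqP/setP e l; have := e l; rewrite !inE => ->.
Qed.

Lemma rank_last (m : nat) (g : 'I_m -> int) b :
  rank g b = m.-1 <-> forall l, ~~ prec g b l.
Proof.
have bm := ltn_ord b.
have sub : [set l | prec g l b] \subset [set~ b].
  by apply/subsetP=> l; rewrite !inE; apply: contraTneq => ->; rewrite prec_irr.
have cb : #|[set~ b]| = m.-1 by rewrite cardsC1 card_ord.
split=> [e l|no].
  have /eqP/setP/(_ l) : [set l | prec g l b] == [set~ b].
    by rewrite eqEcard sub cb -e leqnn.
  rewrite !inE; have [->|_] := eqVneq l b; first by rewrite prec_irr.
  move=> lb; apply/negP=> bl; have := prec_trans lb bl; by rewrite prec_irr.
rewrite /rank -cb; apply: eq_card => l; rewrite !inE.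
have [->|/eqP lb] := eqVneq l b; first by rewrite prec_irr.
by case: (prec_total g lb) => // bl; have := no l; rewrite bl.
Qed.

Section Code.
Variables (m : nat) (a b : 'I_m) (sa sb : bool) (d A B al be : nat).
Hypothesis ab : a <> b.
Hypothesis d_le1 : (d <= 1)%N.
Hypothesis d0 : d = 0%N -> (key sa a < key sb b)%N.
Hypothesis albe : (al <= be <= al.+1)%N.
Hypothesis Aal : A.+1 = (al + m.-1)%N.
Hypothesis Bbe : B.+1 = (be + m.-1)%N.

Lemma AB_of : (A <= B <= A.+1)%N. Proof. by move: albe Aal Bbe; clear; lia. Qed.

Lemma spread_neighbours (g : 'I_m -> int) : consecutive a b sa sb d al be g ->
  neighbours a b sa sb d A.+1 B.+1 (spread g).
Proof.
case=> gB ga gb dist prab gap; split.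
- by rewrite Aal Bbe; apply: spread_box.
- exact: spread_word.
- by rewrite spread_pos.
- by rewrite spread_pos.
- by rewrite !abs_spread (rank_succ prab gap) dist; lia.
- by move=> l; rewrite !spread_lt.
Qed.

Lemma squeeze_consecutive (y : 'I_m -> int) :
  neighbours a b sa sb d A.+1 B.+1 y -> consecutive a b sa sb d al be (squeeze y).
Proof.
case=> yB w ya yb dist gap.
have prab : prec (squeeze y) a b by rewrite squeeze_prec // dist; lia.
have gap' l : ~~ (prec (squeeze y) a l && prec (squeeze y) l b).
  by rewrite !squeeze_prec.
split=> //.
- by apply: squeeze_box => //; rewrite -Aal -Bbe.
- by rewrite squeeze_pos.
- by rewrite squeeze_pos.
- have := abs_spread (squeeze y) b; have := abs_spread (squeeze y) a.
  rewrite !(squeezeK w) (rank_succ prab gap') dist; lia.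
Qed.

Lemma counted_touching (R R' : ('I_m -> int) -> Prop) n :
    (forall g, consecutive a b sa sb d al be g -> R (unstretch a (spread g)) <-> R' g) ->
  counted (fun g : {ffun 'I_m -> int} => consecutive a b sa sb d al be g /\ R' g) n ->
  counted (fun y : {ffun 'I_m -> int} => touching a b sa sb d A B y /\ R y) n.
Proof.
move=> RR'; have AB := AB_of.
apply: (counted_bij (f := fun g : {ffun 'I_m -> int} => finfun (unstretch a (spread g)))
                    (h := fun y : {ffun 'I_m -> int} => finfun (squeeze (stretch a b y)))).
  move=> g [cg R'g]; rewrite !finfunE; have ng := spread_neighbours cg.
  split; first by split; [apply: (unstretch_touching d_le1 d0 AB ng) | apply/RR'].
  apply/ffunP=> i; rewrite ffunE.
  by rewrite (functional_extensionality _ _ (unstretchK d_le1 d0 AB ng)) spreadK.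
move=> y [ty Ry]; rewrite !finfunE.
have ny := stretch_neighbours ab d_le1 d0 AB ty.
have cy := squeeze_consecutive ny.
have [_ w _ _ _ _] := ny.
have e : unstretch a (spread (squeeze (stretch a b y))) = y.
  rewrite (functional_extensionality _ _ (squeezeK w)).
  exact: functional_extensionality (stretchK ab d_le1 d0 AB ty).
split; first by split=> //; apply/(RR' _ cy); rewrite e.
by apply/ffunP=> i; rewrite ffunE e.
Qed.

Lemma decode_nonzero (g : 'I_m -> int) : consecutive a b sa sb d al be g ->
  (forall i, unstretch a (spread g) i <> 0) <-> (forall i, g i <> 0).
Proof.
move=> cg; have [_ w _ _ _ _] := spread_neighbours cg.
split=> nz i e.
  have [p yp] : exists p, spread g p = 0.
    by apply/(squeeze_zero w); exists i; rewrite spreadK.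
  by apply: (nz p); have := abs_unstretch a (spread g) p; rewrite yp; lia.
have := abs_unstretch a (spread g) i; rewrite e => e0.
have [q yq] : exists q, spread g q = 0.
  have [h|h] : spread g i = 0 \/ spread g a = 0; first by move: e0; clear; lia.
    by exists i.
  by exists a.
have [p] := (squeeze_zero w).2 (ex_intro _ q yq).
by rewrite spreadK; apply: nz.
Qed.

(** Label a is in cell 0 when no empty cell and no label precede it. *)
Lemma decode_first (g : 'I_m -> int) : consecutive a b sa sb d al be g ->
  unstretch a (spread g) a = 0 <-> g a = 0 /\ forall l, ~~ prec g l a.
Proof.
move=> cg; have := abs_unstretch a (spread g) a; rewrite ltnn abs_spread => e.
rewrite -rank_first; split=> [e0|[ga ra]].
  by rewrite e0 in e; move: e; clear; lia.
by move: e; rewrite ga ra; clear; lia.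
Qed.

(** Label b is in the extreme cell when all other labels and all empty cells
    precede it. *)
Lemma decode_last (g : 'I_m -> int) : consecutive a b sa sb d al be g ->
  `|unstretch a (spread g) b|%N = B <-> `|g b|%N = be /\ forall l, ~~ prec g b l.
Proof.
move=> cg; have [gB _ _ _ prab _] := cg.
rewrite abs_unstretch spread_lt prab abs_spread -rank_last.
have := gB b; have := rank_max g b; have := rank_lt prab; move: albe Bbe; clear.
by split=> [e|[]]; [split|]; lia.
Qed.
End Code.

(** * Codes in which every label avoids given values *)

Definition intervalz (al be : int) : seq int :=
  [seq al + k%:Z | k <- iota 0 (if al <= be then `|be - al|%N.+1 else 0%N)].

Lemma mem_intervalz al be x : (x \in intervalz al be) = (al <= x <= be).
Proof.
apply/mapP/idP => [[k]|/andP[h1 h2]].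
  by rewrite mem_iota add0n /=; case: ifP => // h1 h2 ->; lia.
exists `|x - al|%N; last lia.
by rewrite mem_iota; case: ifP => h; lia.
Qed.

Lemma intervalz_uniq al be : uniq (intervalz al be).
Proof. by rewrite map_inj_uniq ?iota_uniq // => x y /addrI [->]. Qed.

Lemma size_intervalz al be :
  size (intervalz al be) = if al <= be then `|be - al|%N.+1 else 0%N.
Proof. by rewrite size_map size_iota. Qed.

(** The flag z removes the value 0: it is on in type C and off in type D. *)
Definition nonzeroz (z : bool) (s : seq int) : seq int := [seq x <- s | z ==> (x != 0)].

Lemma mem_nonzeroz z s x : (x \in nonzeroz z s) = (z ==> (x != 0)) && (x \in s).
Proof. exact: mem_filter. Qed.

Lemma nonzeroz_uniq z s : uniq s -> uniq (nonzeroz z s).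
Proof. exact: filter_uniq. Qed.

Lemma size_nonzeroz z s : uniq s -> 0 \in s -> size (nonzeroz z s) = (size s - z)%N.
Proof.
case: z => us s0; last by rewrite /nonzeroz (eq_filter (a2 := predT)) // filter_predT subn0.
have -> : nonzeroz true s = rem 0 s by rewrite rem_filter //; apply: eq_filter.
by rewrite size_rem // subn1.
Qed.

Definition others (m : nat) (i j : 'I_m) (f : 'I_m -> nat) : nat :=
  (\prod_(l | (l != i) && (l != j)) f l)%N.

(** The value of g at a is free in V and determines its value at b; every other
    label avoids a list that depends only on the value at a and whose
    length does not depend on it. *)
Lemma counted_choice (m : nat) (a b : 'I_m) (R V : seq int) (hb : int -> int)
    (forb : int -> 'I_m -> seq int) (phi : 'I_m -> nat) :
    a <> b -> uniq R -> uniq V ->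
    (forall v l, v \in V -> l <> a -> l <> b ->
       [/\ uniq (forb v l), {subset forb v l <= R} & size (forb v l) = phi l]) ->
  counted (fun g : {ffun 'I_m -> int} =>
      [/\ g a \in V, g b = hb (g a) &
          forall l, l <> a -> l <> b -> g l \in R /\ g l \notin forb (g a) l])
    (size V * others a b (fun l => size R - phi l))%N.
Proof.
move=> /eqP ab uR uV fP.
apply: (counted_fibers (p := fun g : {ffun 'I_m -> int} => g a) uV); first by move=> g [].
move=> v vV.
pose A l := if l == a then [:: v] else if l == b then [:: hb v] else
  [seq x <- R | x \notin forb v l].
have uA l : uniq (A l) by rewrite /A; do 2!case: ifP => // _; rewrite filter_uniq.
have -> : others a b (fun l => size R - phi l)%N = (\prod_l size (A l))%N.
  have sa : size (A a) = 1%N by rewrite /A eqxx.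
  have sb : size (A b) = 1%N by rewrite /A [b == a]eq_sym (negPf ab) eqxx.
  rewrite (bigD1 a) //= (bigD1 b) ?[b == a]eq_sym //= sa sb !mul1n.
  apply: eq_bigr => l /andP[la lb]; rewrite /A (negPf la) (negPf lb).
  have [uf sf <-] := fP v l vV (elimN eqP la) (elimN eqP lb).
  rewrite size_filter -[size R](count_predC [in forb v l]).
  have -> : count [in forb v l] R = size (forb v l); last by rewrite addKn.
  rewrite -size_filter; apply/perm_size/uniq_perm; rewrite ?filter_uniq // => x.
  by rewrite mem_filter /=; case: (boolP (x \in forb v l)) => //= /sf ->.
apply: counted_ext (counted_family uA) => g; split=> [gA|[[ga gb gl] gv] l]; last first.
  move: gb gl; rewrite gv => gb gl.
  rewrite /A; have [->|/eqP la] := eqVneq l a; first by rewrite inE gv.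
  have [->|/eqP lb] := eqVneq l b; first by rewrite inE gb.
  by have [h1 h2] := gl l la lb; rewrite mem_filter h1 h2.

have ga : g a = v by have := gA a; rewrite /A eqxx inE => /eqP.
have gb : g b = hb v by have := gA b; rewrite /A [b == a]eq_sym (negPf ab) eqxx inE => /eqP.
split=> //; split; rewrite ga // => l la lb.
by have := gA l; rewrite /A (introF eqP la) (introF eqP lb) mem_filter => /andP[].
Qed.

Definition alphabet (z : bool) (al be : nat) : seq int :=
  nonzeroz z (intervalz (- al%:Z) be%:Z).

Lemma mem_alphabet z al be x :
  (x \in alphabet z al be) = (z ==> (x != 0)) && (- al%:Z <= x <= be%:Z).
Proof. by rewrite mem_nonzeroz mem_intervalz. Qed.

Lemma size_alphabet z al be : size (alphabet z al be) = (al + be + 1 - z)%N.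
Proof.
rewrite size_nonzeroz ?intervalz_uniq //; last by rewrite mem_intervalz; lia.
by rewrite size_intervalz; case: ifP; lia.
Qed.

Lemma counted_consecutive (m : nat) (a b : 'I_m) (sa sb : bool) (d al be : nat)
    (z : bool) (V : seq int) (hb : int -> int) (forb : int -> 'I_m -> seq int)
    (phi : 'I_m -> nat) (Q : ('I_m -> int) -> Prop) :
    a <> b -> uniq V ->
    (forall v l, v \in V -> l <> a -> l <> b ->
       [/\ uniq (forb v l), {subset forb v l <= alphabet z al be}
         & size (forb v l) = phi l]) ->
    (forall v, v \in V -> [/\ v \in alphabet z al be, hb v \in alphabet z al be,
       (0 < v) = sa, (0 < hb v) = sb & `|hb v|%N = (`|v| + d)%N]) ->
    (forall g : 'I_m -> int, consecutive a b sa sb d al be g ->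
       (z -> forall l, g l <> 0) -> Q g -> g a \in V /\ g b = hb (g a)) ->
    (forall g : 'I_m -> int, g a \in V -> g b = hb (g a) ->
       (forall l, l <> a -> l <> b -> g l \in alphabet z al be) ->
       ([/\ prec g a b, forall l, ~~ (prec g a l && prec g l b) & Q g] <->
        forall l, l <> a -> l <> b -> g l \notin forb (g a) l)) ->
  counted (fun g : {ffun 'I_m -> int} =>
      consecutive a b sa sb d al be g /\ ((z -> forall l, g l <> 0) /\ Q g))
    (size V * others a b (fun l => al + be + 1 - z - phi l))%N.
Proof.
move=> ab uV fP vP toV Qf; have uR : uniq (alphabet z al be).
  by rewrite nonzeroz_uniq // intervalz_uniq.
have := counted_choice hb ab uR uV fP; rewrite size_alphabet.
apply: counted_ext => g; split=> [[ga gb gl]|[cg [nz Qg]]].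
  have [aR hbR sga sgb dist] := vP _ ga; rewrite -gb in hbR sgb dist.
  have gR l : g l \in alphabet z al be.
    have [->//|/eqP la] := eqVneq l a; have [->//|/eqP lb] := eqVneq l b.
    by have [] := gl l la lb.
  have [|prab gap Qg] := (Qf g ga gb (fun l _ _ => gR l)).2.
    by move=> l la lb; have [] := gl l la lb.
  split; first by split=> // l; have := gR l; rewrite mem_alphabet => /andP[].
  by split=> // zT l; have := gR l; rewrite mem_alphabet zT => /andP[/eqP].
have [ga gb] := toV _ cg nz Qg.
have gR l : g l \in alphabet z al be.
  rewrite mem_alphabet; case: cg => /(_ l) -> _ _ _ _ _; rewrite andbT.
  by apply/implyP=> zT; apply/eqP; apply: nz.
split=> // l la lb; split=> //; have [gB _ _ _ prab gap] := cg.
by apply: (Qf g ga gb (fun l _ _ => gR l)).1.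
Qed.

(** * The codes of each kind of pair *)

Definition prec_at (m : nat) (x : int) (l : 'I_m) (y : int) (i : 'I_m) : bool :=
  (`|x| < `|y|)%N || (`|x|%N == `|y|%N) && (key (0 < x)%R l < key (0 < y)%R i)%N.

(** The flags single out the words in which a is in cell 0, respectively b is in
    the extreme cell. *)
Definition code_extreme (m : nat) (first last : bool) (a b : 'I_m) (be : nat)
    (g : 'I_m -> int) : Prop :=
  (first -> g a = 0 /\ forall l, ~~ prec g l a) /\
  (last -> `|g b|%N = be /\ forall l, ~~ prec g b l).

(** Label l with code x would break one of the conditions on a and b. *)
Definition blocked (m : nat) (first last : bool) (a b : 'I_m) (va vb : int)
    (l : 'I_m) (x : int) : bool :=
  [|| prec_at va a x l && prec_at x l vb b, first && prec_at x l va a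
    | last && prec_at vb b x l].

(** All conditions on a code beyond its values at a and b concern one other label
    at a time, so they become lists of forbidden values. *)
Lemma counted_extreme_codes (m : nat) (a b : 'I_m) (sa sb : bool) (d al be : nat)
    (z first last : bool) (V : seq int) (hb : int -> int)
    (forb : int -> 'I_m -> seq int) (phi : 'I_m -> nat) (n : nat) :
    a <> b -> uniq V -> size V = n ->
    (forall v l, v \in V -> l <> a -> l <> b ->
       [/\ uniq (forb v l), {subset forb v l <= alphabet z al be}
         & size (forb v l) = phi l]) ->
    (forall v, v \in V -> [/\ v \in alphabet z al be, hb v \in alphabet z al be,
       (0 < v) = sa, (0 < hb v) = sb & `|hb v|%N = (`|v| + d)%N]) ->
    (forall v, v \in V -> [/\ prec_at v a (hb v) b, first -> v = 0 &
       last -> `|hb v|%N = be]) ->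
    (forall v w, v \in alphabet z al be -> w \in alphabet z al be ->
       (0 < v) = sa -> (0 < w) = sb -> `|w|%N = (`|v| + d)%N ->
       (first -> v = 0) -> (last -> `|w|%N = be) -> v \in V /\ w = hb v) ->
    (forall v l x, v \in V -> l <> a -> l <> b -> x \in alphabet z al be ->
       blocked first last a b v (hb v) l x = (x \in forb v l)) ->
  counted (fun g : {ffun 'I_m -> int} =>
      consecutive a b sa sb d al be g /\
      ((z -> forall l, g l <> 0) /\ code_extreme first last a b be g))
    (n * others a b (fun l => al + be + 1 - z - phi l))%N.
Proof.
move=> ab uV <- fP vP vP' toV bl.
apply: (counted_consecutive ab uV fP vP) => [g cg nz [gf gl]|g ga gb gR].
  have gR l : g l \in alphabet z al be.
    rewrite mem_alphabet; case: cg => /(_ l) -> _ _ _ _ _; rewrite andbT.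
    by apply/implyP=> zT; apply/eqP; apply: nz.
  case: cg => _ ga gb dist _ _.
  by apply: toV => // [/gf[]|/gl[]].
have [pv fv lv] := vP' _ ga; rewrite -gb in pv lv.
have prab : prec g a b := pv.
split=> [[_ gap [gf gl]] l la lb|ok].
  rewrite -bl -?gb //; last exact: gR.
  rewrite /blocked negb_or gap /= negb_or.
  apply/andP; split; apply/negP=> /andP[].
    by move=> /gf[_ /(_ l)]; rewrite /prec /prec_at => /negPf ->.
  by move=> /gl[_ /(_ l)]; rewrite /prec /prec_at => /negPf ->.
have free l : l <> a -> l <> b -> ~~ blocked first last a b (g a) (g b) l (g l).
  by move=> la lb; rewrite gb bl ?ok //; apply: gR.
have pba : ~~ prec g b a.
  by apply/negP=> h; have := prec_trans prab h; rewrite prec_irr.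
split=> //; first move=> l.
  have [->|/eqP la] := eqVneq l a; first by rewrite prec_irr.
  have [->|/eqP lb] := eqVneq l b; first by rewrite prec_irr andbF.
  by have := free l la lb; rewrite /blocked negb_or => /andP[].
split=> h; split; rewrite ?fv ?lv // => l.
  have [->|/eqP la] := eqVneq l a; first by rewrite prec_irr.
  have [->//|/eqP lb] := eqVneq l b.
  by have := free l la lb; rewrite /blocked h !negb_or => /and3P[].
have [->//|/eqP la] := eqVneq l a.
have [->|/eqP lb] := eqVneq l b; first by rewrite prec_irr.
by have := free l la lb; rewrite /blocked h !negb_or => /and3P[].
Qed.

Definition seq_if (c : bool) (v : int) : seq int := if c then [:: v] else [::].

Lemma mem_seq_if c v x : (x \in seq_if c v) = c && (x == v).
Proof. by case: c; rewrite ?inE. Qed.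

(** In every case below a label has at most three forbidden values w1, w2, w3,
    each of them subject to a condition on the label alone. *)
Lemma counted_codes (m : nat) (a b : 'I_m) (sa sb : bool) (d al be : nat)
    (z first last : bool) (V : seq int) (hb w1 w2 w3 : int -> int)
    (c1 c2 c3 : 'I_m -> bool) (n : nat) :
    a <> b -> uniq V -> size V = n ->
    (forall v, v \in V -> [/\ v \in alphabet z al be, hb v \in alphabet z al be,
       (0 < v) = sa, (0 < hb v) = sb & `|hb v|%N = (`|v| + d)%N]) ->
    (forall v, v \in V -> [/\ prec_at v a (hb v) b, first -> v = 0 &
       last -> `|hb v|%N = be]) ->
    (forall v w, v \in alphabet z al be -> w \in alphabet z al be ->
       (0 < v) = sa -> (0 < w) = sb -> `|w|%N = (`|v| + d)%N ->
       (first -> v = 0) -> (last -> `|w|%N = be) -> v \in V /\ w = hb v) ->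
    (forall (v : int) (l : 'I_m), v \in V -> l <> a :> nat -> l <> b :> nat ->
       [/\ c1 l -> w1 v \in alphabet z al be, c2 l -> w2 v \in alphabet z al be,
           c3 l -> w3 v \in alphabet z al be
         & [/\ c1 l -> c2 l -> w1 v <> w2 v, c1 l -> c3 l -> w1 v <> w3 v
         & c2 l -> c3 l -> w2 v <> w3 v]]) ->
    (forall (v : int) (l : 'I_m) (x : int), v \in V -> l <> a :> nat -> l <> b :> nat ->
       x \in alphabet z al be -> blocked first last a b v (hb v) l x =
       [|| c1 l && (x == w1 v), c2 l && (x == w2 v) | c3 l && (x == w3 v)]) ->
  counted (fun g : {ffun 'I_m -> int} =>
      consecutive a b sa sb d al be g /\
      ((z -> forall l, g l <> 0) /\ code_extreme first last a b be g))
    (n * others a b (fun l => al + be + 1 - z - (c1 l + c2 l + c3 l)))%N.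
Proof.
move=> ab uV sV vP vP' toV fP bl.
apply: (counted_extreme_codes (hb := hb) (V := V) (forb := fun v l =>
  seq_if (c1 l) (w1 v) ++ seq_if (c2 l) (w2 v) ++ seq_if (c3 l) (w3 v))) => //.
  move=> v l vV la lb.
  have {}la : l <> a :> nat by move/val_inj.
  have {}lb : l <> b :> nat by move/val_inj.
  have [f1 f2 f3 [n12 n13 n23]] := fP v l vV la lb; split.
  - move: n12 n13 n23; rewrite /seq_if; clear.
    by case: (c1 l); case: (c2 l); case: (c3 l) => //= n12 n13 n23;
      rewrite ?inE ?andbT ?negb_or; do ?(apply/andP; split); apply/eqP; auto.
  - by move=> x; rewrite !mem_cat !mem_seq_if => /or3P[] /andP[/[swap] /eqP ->].
  - by rewrite !size_cat /seq_if addnA; case: (c1 l); case: (c2 l); case: (c3 l).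
move=> v l x vV la lb xR; rewrite !mem_cat !mem_seq_if bl //.
- by move=> /val_inj.
- by move=> /val_inj.
Qed.

Lemma ord_neq (m : nat) (i j : 'I_m) : (i < j)%N -> i <> j.
Proof. by move=> ij e; rewrite e ltnn in ij. Qed.

(** Goals in the order of the hypotheses of [counted_codes]; in the last one the
    cells and signed labels of l, a and b are compared case by case. *)
Ltac solve_codes :=
  [> by [done|exact: nesym|exact: ord_neq|exact: nesym (ord_neq _)]
   | by rewrite ?intervalz_uniq
   | rewrite ?size_intervalz //; try (case: ifP; lia)
   | move=> v; rewrite ?mem_intervalz ?inE !mem_alphabet => vV; split; lia
   | move=> v; rewrite ?mem_intervalz ?inE /prec_at /key => vV; split;
     [repeat (case: ltrP => ?); lia | lia | lia]
   | move=> v w; rewrite ?mem_intervalz ?inE !mem_alphabet; lia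
   | move=> v l; have lm := ltn_ord l; rewrite ?mem_intervalz ?inE !mem_alphabet => vV li lj;
     split; [lia | lia | lia | split; lia]
   | move=> v l x; have lm := ltn_ord l;
     rewrite ?mem_intervalz ?inE mem_alphabet /blocked /prec_at /key => vV li lj xV;
     repeat (case: ltrP => ?); lia ].

(** Labels i and j with the same sign in one cell, which is read as i followed by
    j, respectively as -j followed by -i. A label between i and j is then barred
    from their run. *)
Lemma codes_equal_pos (m : nat) (i j : 'I_m) (al be : nat) (z : bool) :
    (i < j)%N -> (0 < al)%N -> (al <= be <= al.+1)%N ->
  counted (fun g : {ffun 'I_m -> int} =>
      consecutive i j true true 0 al be g /\
      ((z -> forall l, g l <> 0) /\ code_extreme false false i j be g))
    (be * others i j (fun l => al + be + 1 - z - ((i < l < j) + false + false)))%N.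
Proof.
move=> ij al0 albe; have im := ltn_ord i; have jm := ltn_ord j.
apply: (counted_codes (V := intervalz 1 be) (hb := id)
  (c1 := fun l : 'I_m => (i < l < j)%N) (w1 := id)
  (c2 := xpred0) (w2 := id) (c3 := xpred0) (w3 := id)).
all: solve_codes.
Qed.

Lemma codes_equal_neg (m : nat) (i j : 'I_m) (al be : nat) (z : bool) :
    (i < j)%N -> (0 < al)%N -> (al <= be <= al.+1)%N ->
  counted (fun g : {ffun 'I_m -> int} =>
      consecutive j i false false 0 al be g /\
      ((z -> forall l, g l <> 0) /\ code_extreme false false j i be g))
    ((al + ~~ z) * others j i (fun l => al + be + 1 - z - ((i < l < j) + false + false)))%N.
Proof.
move=> ij al0 albe; have im := ltn_ord i; have jm := ltn_ord j.
apply: (counted_codes (V := intervalz (- al%:Z) (- (z : nat)%:Z)) (hb := id)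
  (c1 := fun l : 'I_m => (i < l < j)%N) (w1 := id)
  (c2 := xpred0) (w2 := id) (c3 := xpred0) (w3 := id)).
all: solve_codes.
Qed.

(** Both labels in cell 0. *)
Lemma codes_equal_first (m : nat) (i j : 'I_m) (al be : nat) :
    (i < j)%N -> (1 < al)%N -> (al <= be <= al.+1)%N ->
  counted (fun g : {ffun 'I_m -> int} =>
      consecutive j i false false 0 al be g /\
      ((false -> forall l, g l <> 0) /\ code_extreme true false j i be g))
    (1 * others j i (fun l => al + be + 1 - false -
       ((i < l)%N + false + false)))%N.
Proof.
move=> ij al1 albe; have im := ltn_ord i; have jm := ltn_ord j.
apply: (counted_codes (V := [:: 0]) (hb := id)
  (c1 := fun l : 'I_m => (i < l)%N) (w1 := id)
  (c2 := fun l : 'I_m => false) (w2 := id)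
  (c3 := fun l : 'I_m => false) (w3 := id)).
all: solve_codes.
Qed.

(** Both labels in the extreme cell on the positive side. *)
Lemma codes_equal_last_pos (m : nat) (i j : 'I_m) (al be : nat) :
    (i < j)%N -> (1 < al)%N -> be = al.+1 ->
  counted (fun g : {ffun 'I_m -> int} =>
      consecutive i j true true 0 al be g /\
      ((false -> forall l, g l <> 0) /\ code_extreme false true i j be g))
    (1 * others i j (fun l => al + be + 1 - false -
       ((i < l)%N + false + false)))%N.
Proof.
move=> ij al1 albe; have im := ltn_ord i; have jm := ltn_ord j.
apply: (counted_codes (V := [:: be%:Z]) (hb := id)
  (c1 := fun l : 'I_m => (i < l)%N) (w1 := id)
  (c2 := fun l : 'I_m => false) (w2 := id)
  (c3 := fun l : 'I_m => false) (w3 := id)).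
all: solve_codes.
Qed.

(** Both labels in the extreme cell on the negative side. *)
Lemma codes_equal_last_neg (m : nat) (i j : 'I_m) (al be : nat) :
    (i < j)%N -> (1 < al)%N -> be = al ->
  counted (fun g : {ffun 'I_m -> int} =>
      consecutive j i false false 0 al be g /\
      ((false -> forall l, g l <> 0) /\ code_extreme false true j i be g))
    (1 * others j i (fun l => al + be + 1 - false -
       ((l < j)%N + false + false)))%N.
Proof.
move=> ij al1 albe; have im := ltn_ord i; have jm := ltn_ord j.
apply: (counted_codes (V := [:: - be%:Z]) (hb := id)
  (c1 := fun l : 'I_m => (l < j)%N) (w1 := id)
  (c2 := fun l : 'I_m => false) (w2 := id)
  (c3 := fun l : 'I_m => false) (w3 := id)).
all: solve_codes.
Qed.

(** Labels i and -j in one cell; their run contains none of the signed labels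
    between i and -j, of either sign. *)
Lemma codes_opposite (m : nat) (i j : 'I_m) (al be : nat) (z : bool) :
    i <> j -> (1 < al)%N -> (al <= be <= al.+1)%N ->
  counted (fun g : {ffun 'I_m -> int} =>
      consecutive i j true false 0 al be g /\
      ((z -> forall l, g l <> 0) /\ code_extreme false false i j be g))
    (al * others i j (fun l => al + be + 1 - z -
       ((i < l)%N + (j < l)%N + false)))%N.
Proof.
move=> ij al1 albe; have im := ltn_ord i; have jm := ltn_ord j.
have ijn : i <> j :> nat by move/val_inj.
apply: (counted_codes (V := intervalz 1 al) (hb := -%R)
  (c1 := fun l : 'I_m => (i < l)%N) (w1 := id)
  (c2 := fun l : 'I_m => (j < l)%N) (w2 := -%R)
  (c3 := fun l : 'I_m => false) (w3 := id)).
all: solve_codes.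
Qed.

(** Labels j and -i in the extreme cell, so that no label follows -i. *)
Lemma codes_opposite_last (m : nat) (i j : 'I_m) (al be : nat) :
    (i < j)%N -> (1 < al)%N -> be = al ->
  counted (fun g : {ffun 'I_m -> int} =>
      consecutive j i true false 0 al be g /\
      ((false -> forall l, g l <> 0) /\ code_extreme false true j i be g))
    (1 * others j i (fun l => al + be + 1 - false -
       ((j < l)%N + true + false)))%N.
Proof.
move=> ij al1 albe; have im := ltn_ord i; have jm := ltn_ord j.
apply: (counted_codes (V := [:: be%:Z]) (hb := -%R)
  (c1 := fun l : 'I_m => (j < l)%N) (w1 := id)
  (c2 := fun l : 'I_m => true) (w2 := -%R)
  (c3 := fun l : 'I_m => false) (w3 := id)).
all: solve_codes.
Qed.

(** Label j directly followed by i < j: two runs, one ending in j and one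
    beginning with i, separated by the inserted cell. *)
Lemma codes_succ_pos (m : nat) (i j : 'I_m) (al be : nat) (z : bool) :
    (i < j)%N -> (1 < al)%N -> (al <= be <= al.+1)%N ->
  counted (fun g : {ffun 'I_m -> int} =>
      consecutive j i true true 1 al be g /\
      ((z -> forall l, g l <> 0) /\ code_extreme false false j i be g))
    (be.-1 * others j i (fun l => al + be + 1 - z -
       ((j < l)%N + true + (l < i)%N)))%N.
Proof.
move=> ij al1 albe; have im := ltn_ord i; have jm := ltn_ord j.
apply: (counted_codes (V := intervalz 1 be.-1) (hb := (fun v => v + 1))
  (c1 := fun l : 'I_m => (j < l)%N) (w1 := id)
  (c2 := fun l : 'I_m => true) (w2 := -%R)
  (c3 := fun l : 'I_m => (l < i)%N) (w3 := (fun v => v + 1))).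
all: solve_codes.
Qed.

(** The mirror image: -i directly followed by -j. *)
Lemma codes_succ_neg (m : nat) (i j : 'I_m) (al be : nat) (z : bool) :
    (i < j)%N -> (1 < al)%N -> (al <= be <= al.+1)%N ->
  counted (fun g : {ffun 'I_m -> int} =>
      consecutive i j false false 1 al be g /\
      ((z -> forall l, g l <> 0) /\ code_extreme false false i j be g))
    ((al - z) * others i j (fun l => al + be + 1 - z -
       ((l < i)%N + true + (j < l)%N)))%N.
Proof.
move=> ij al1 albe; have im := ltn_ord i; have jm := ltn_ord j.
apply: (counted_codes (V := intervalz (1 - al%:Z) (- (z : nat)%:Z)) (hb := (fun v => v - 1))
  (c1 := fun l : 'I_m => (l < i)%N) (w1 := id)
  (c2 := fun l : 'I_m => true) (w2 := (fun v => 1 - v))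
  (c3 := fun l : 'I_m => (j < l)%N) (w3 := (fun v => v - 1))).
all: solve_codes.
Qed.

(** Label -j directly followed by i, whichever of i and j is larger. *)
Lemma codes_sum (m : nat) (i j : 'I_m) (al be : nat) (z : bool) :
    i <> j -> (1 < al)%N -> (al <= be <= al.+1)%N ->
  counted (fun g : {ffun 'I_m -> int} =>
      consecutive j i false true 1 al be g /\
      ((z -> forall l, g l <> 0) /\ code_extreme false false j i be g))
    ((be - z) * others j i (fun l => al + be + 1 - z -
       ((l < j)%N + (l < i)%N + false)))%N.
Proof.
move=> ij al1 albe; have im := ltn_ord i; have jm := ltn_ord j.
have ijn : i <> j :> nat by move/val_inj.
apply: (counted_codes (V := intervalz (1 - be%:Z) (- (z : nat)%:Z)) (hb := (fun v => 1 - v))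
  (c1 := fun l : 'I_m => (l < j)%N) (w1 := id)
  (c2 := fun l : 'I_m => (l < i)%N) (w2 := (fun v => 1 - v))
  (c3 := fun l : 'I_m => false) (w3 := id)).
all: solve_codes.
Qed.

(** Label -j in cell 0 and i in cell 1. *)
Lemma codes_sum_first (m : nat) (i j : 'I_m) (al be : nat) :
    i <> j -> (1 < al)%N -> (al <= be <= al.+1)%N ->
  counted (fun g : {ffun 'I_m -> int} =>
      consecutive j i false true 1 al be g /\
      ((false -> forall l, g l <> 0) /\ code_extreme true false j i be g))
    (1 * others j i (fun l => al + be + 1 - false -
       (true + (l < i)%N + false)))%N.
Proof.
move=> ij al1 albe; have im := ltn_ord i; have jm := ltn_ord j.
have ijn : i <> j :> nat by move/val_inj.
apply: (counted_codes (V := [:: 0]) (hb := (fun v => 1 - v))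
  (c1 := fun l : 'I_m => true) (w1 := id)
  (c2 := fun l : 'I_m => (l < i)%N) (w2 := (fun v => 1 - v))
  (c3 := fun l : 'I_m => false) (w3 := id)).
all: solve_codes.
Qed.

(** Label j in the extreme cell, directly preceded by -i. *)
Lemma codes_sum_last (m : nat) (i j : 'I_m) (al be : nat) :
    i <> j -> (1 < al)%N -> be = al.+1 ->
  counted (fun g : {ffun 'I_m -> int} =>
      consecutive i j false true 1 al be g /\
      ((false -> forall l, g l <> 0) /\ code_extreme false true i j be g))
    (1 * others i j (fun l => al + be + 1 - false -
       (true + (l < i)%N + false)))%N.
Proof.
move=> ij al1 albe; have im := ltn_ord i; have jm := ltn_ord j.
have ijn : i <> j :> nat by move/val_inj.
apply: (counted_codes (V := [:: 1 - be%:Z]) (hb := (fun v => 1 - v))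
  (c1 := fun l : 'I_m => true) (w1 := (fun v => 1 - v))
  (c2 := fun l : 'I_m => (l < i)%N) (w2 := id)
  (c3 := fun l : 'I_m => false) (w3 := id)).
all: solve_codes.
Qed.

(** * Words in which one pair coincides or descends *)

(** Counting with values in the rationals, where subtraction is total. *)
Definition has_count (T : eqType) (P : T -> Prop) (x : rat) : Prop :=
  exists2 n, counted P n & n%:R = x.

Lemma has_count_ext (T : eqType) (P Q : T -> Prop) x :
  (forall y, P y <-> Q y) -> has_count P x -> has_count Q x.
Proof. by move=> PQ [n cP e]; exists n => //; apply: counted_ext cP. Qed.

Lemma has_count_or (T : eqType) (P Q : T -> Prop) x x' :
    (forall y, P y -> Q y -> False) -> has_count P x -> has_count Q x' ->
  has_count (fun y => P y \/ Q y) (x + x').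
Proof.
move=> PQ [n cP <-] [k cQ <-]; exists (n + k)%N; last by rewrite natrD.
exact: counted_or.
Qed.

Lemma has_count_diff (T : eqType) (P Q : T -> Prop) x x' :
    (forall y, Q y -> P y) -> has_count P x -> has_count Q x' ->
  has_count (fun y => P y /\ ~ Q y) (x - x').
Proof.
move=> QP [n cP <-] [k cQ <-]; have [kn cPQ] := counted_diff QP cP cQ.
by exists (n - k)%N => //; rewrite natrB.
Qed.

(** The product over the labels other than i and j of X - phi l, to be evaluated
    at the number X of available codes. *)
Definition others_poly (m : nat) (i j : 'I_m) (phi : 'I_m -> nat) : {poly rat} :=
  \prod_(l | (l != i) && (l != j)) ('X - (phi l)%:R%:P).

Lemma others_polyC (m : nat) (i j : 'I_m) phi : others_poly j i phi = others_poly i j phi.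
Proof. by apply: eq_bigl => l; rewrite andbC. Qed.

Lemma eq_others_poly (m : nat) (i j : 'I_m) (phi psi : 'I_m -> nat) :
  (forall l : 'I_m, l <> i :> nat -> l <> j :> nat -> phi l = psi l) ->
  others_poly i j phi = others_poly i j psi.
Proof.
move=> e; apply: eq_bigr => l /andP[/eqP li /eqP lj]; rewrite e //.
  by move/val_inj.
by move/val_inj.
Qed.

Lemma horner_others_poly (m : nat) (i j : 'I_m) (phi : 'I_m -> nat) x :
  (others_poly i j phi).[x] = \prod_(l | (l != i) && (l != j)) (x - (phi l)%:R).
Proof. by rewrite horner_prod; apply: eq_bigr => l _; rewrite !hornerE. Qed.

Lemma natr_others (m : nat) (i j : 'I_m) (phi : 'I_m -> nat) (t : nat) :
    (forall l : 'I_m, l <> i :> nat -> l <> j :> nat -> (phi l <= t)%N) ->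
  (others i j (fun l => t - phi l)%N)%:R = (others_poly i j phi).[t%:R].
Proof.
move=> le; rewrite horner_others_poly natr_prod; apply: eq_bigr => l /andP[/eqP li /eqP lj].
by rewrite natrB // le // => /val_inj.
Qed.

Definition word_extreme (m : nat) (z first last : bool) (a b : 'I_m) (B : nat)
    (y : 'I_m -> int) : Prop :=
  (z -> forall l, y l <> 0) /\ ((first -> y a = 0) /\ (last -> `|y b|%N = B)).

Lemma word_but_sym (m : nat) (i j : 'I_m) (y : 'I_m -> int) :
  word_but i j y -> word_but j i y.
Proof. by move=> w a b ab n1 n2; apply: w. Qed.

Definition pair_words (m : nat) (i j : 'I_m) (A B : nat) (z : bool)
    (rel : int -> int -> Prop) (y : 'I_m -> int) : Prop :=
  [/\ inbox A B y, word_but i j y, rel (y i) (y j) & z -> forall l, y l <> 0].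

Section Touch.
Variables (m : nat) (i j : 'I_m) (A B al be : nat).
Hypothesis al1 : (1 < al)%N.
Hypothesis albe : (al <= be <= al.+1)%N.
Hypothesis Aal : A.+1 = (al + m.-1)%N.
Hypothesis Bbe : B.+1 = (be + m.-1)%N.

(** The bound on phi keeps the subtraction of naturals exact. *)
Lemma words_touching (a b : 'I_m) (sa sb : bool) (d : nat) (z first last : bool)
    (n : nat) (phi : 'I_m -> nat) :
    a <> b -> (d <= 1)%N -> (d = 0%N -> (key sa a < key sb b)%N) ->
    (forall l : 'I_m, l <> a :> nat -> l <> b :> nat -> (phi l <= al + be + 1 - z)%N) ->
  counted (fun g : {ffun 'I_m -> int} =>
      consecutive a b sa sb d al be g /\
      ((z -> forall l, g l <> 0) /\ code_extreme first last a b be g))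
    (n * others a b (fun l => al + be + 1 - z - phi l))%N ->
  has_count (fun y : {ffun 'I_m -> int} =>
      touching a b sa sb d A B y /\ word_extreme z first last a b B y)
    (n%:R * (others_poly a b phi).[(al + be + 1 - z)%:R]).
Proof.
move=> ab d1 d0 le c; eexists; last by rewrite -natr_others // -natrM.
apply: (counted_touching (R := word_extreme z first last a b B)
  (R' := fun g => (z -> forall l, g l <> 0) /\ code_extreme first last a b be g)
  ab d1 d0 albe Aal Bbe _ c) => g cg.
have [n1 n2] := decode_nonzero d1 d0 albe Aal Bbe cg.
have [f1 f2] := decode_first cg.
have [l1 l2] := decode_last albe Bbe cg.
rewrite /word_extreme /code_extreme; split=> [[h1 [h2 h3]]|[h1 [h2 h3]]].
  by split; [auto|split; auto].
by split; [auto|split; auto].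
Qed.

Lemma pair_wordsP (a b : 'I_m) (sa sb : bool) (d : nat) (z first last : bool) rel
    (y : 'I_m -> int) :
    (forall u v, - A%:Z <= u <= B%:Z -> - A%:Z <= v <= B%:Z -> rel u v <->
       [/\ (0 < u) = sa, (0 < v) = sb, `|v|%N = (`|u| + d)%N, first -> u = 0
         & last -> `|v|%N = B]) ->
  touching a b sa sb d A B y /\ word_extreme z first last a b B y <->
  pair_words a b A B z rel y.
Proof.
move=> relP; split=> [[[yB w ya yb dist] [nz [f l]]]|[yB w ryab nz]].
  by split=> //; apply/relP.
have [ya yb dist f l] := (relP _ _ (yB a) (yB b)).1 ryab.
by split; split.
Qed.

Lemma pair_words_sym (a b : 'I_m) z rel (y : 'I_m -> int) :
  pair_words a b A B z rel y <-> pair_words b a A B z (fun u v => rel v u) y.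
Proof. by split=> -[yB w r nz]; split=> //; apply: word_but_sym. Qed.

Let N (z : bool) : rat := (al + be + 1 - z)%:R.

Lemma words_pair (a b : 'I_m) (sa sb : bool) (d : nat) (z first last : bool)
    (n : nat) (phi psi : 'I_m -> nat) rel :
    a <> b -> (d <= 1)%N -> (d = 0%N -> (key sa a < key sb b)%N) ->
  counted (fun g : {ffun 'I_m -> int} =>
      consecutive a b sa sb d al be g /\
      ((z -> forall l, g l <> 0) /\ code_extreme first last a b be g))
    (n * others a b (fun l => al + be + 1 - z - phi l))%N ->
    (forall l : 'I_m, l <> a :> nat -> l <> b :> nat -> phi l = psi l /\ (phi l <= 3)%N) ->
    (forall u v, - A%:Z <= u <= B%:Z -> - A%:Z <= v <= B%:Z -> rel u v <->
       [/\ (0 < u) = sa, (0 < v) = sb, `|v|%N = (`|u| + d)%N, first -> u = 0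
         & last -> `|v|%N = B]) ->
  has_count (fun y : {ffun 'I_m -> int} =>
      pair_words a b A B z rel y)
    (n%:R * (others_poly a b psi).[N z]).
Proof.
move=> ab d1 d0 c phiP relP.
have -> : others_poly a b psi = others_poly a b phi.
  by apply: eq_others_poly => l la lb; rewrite (phiP l la lb).1.
apply: has_count_ext (words_touching ab d1 d0 _ c) => [y|l la lb].
  exact: pair_wordsP.
by have := (phiP l la lb).2; move: al1 albe; clear; case: z; lia.
Qed.

Lemma words_pair_sym (a b : 'I_m) (z : bool) rel psi (x : rat) :
  has_count (fun y : {ffun 'I_m -> int} =>
      pair_words a b A B z rel y)
    (x * (others_poly a b psi).[N z]) ->
  has_count (fun y : {ffun 'I_m -> int} =>
      pair_words b a A B z (fun u v => rel v u) y)
    (x * (others_poly b a psi).[N z]).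
Proof.
rewrite others_polyC; apply: has_count_ext => y; exact: pair_words_sym.
Qed.

Lemma words_pair_or (a b : 'I_m) (z : bool) (rel rel1 rel2 : int -> int -> Prop) (x1 x2 : rat) :
    (forall u v, - A%:Z <= u <= B%:Z -> - A%:Z <= v <= B%:Z ->
       (z -> u <> 0) -> (z -> v <> 0) ->
       (rel u v <-> rel1 u v \/ rel2 u v) /\ (rel1 u v -> rel2 u v -> False)) ->
  has_count (fun y : {ffun 'I_m -> int} =>
      pair_words a b A B z rel1 y) x1 ->
  has_count (fun y : {ffun 'I_m -> int} =>
      pair_words a b A B z rel2 y) x2 ->
  has_count (fun y : {ffun 'I_m -> int} =>
      pair_words a b A B z rel y) (x1 + x2).
Proof.
move=> relP c1 c2; apply: has_count_ext (has_count_or _ c1 c2) => [y|y [yB w r1 nz] [_ _ r2 _]].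
  split=> [[] [yB w r nz]|[yB w r nz]];
    have [relE _] := relP _ _ (yB a) (yB b) (fun h => nz h a) (fun h => nz h b).
  - by split=> //; apply/relE; left.
  - by split=> //; apply/relE; right.
  - by case/relE: r => r; [left | right].
have [_ h] := relP _ _ (yB a) (yB b) (fun h => nz h a) (fun h => nz h b).
exact: h r1 r2.
Qed.

Lemma words_pair_diff (a b : 'I_m) (z : bool) (rel rel1 rel2 : int -> int -> Prop) (x1 x2 : rat) :
    (forall u v, - A%:Z <= u <= B%:Z -> - A%:Z <= v <= B%:Z ->
       (rel u v <-> rel1 u v /\ ~ rel2 u v) /\ (rel2 u v -> rel1 u v)) ->
  has_count (fun y : {ffun 'I_m -> int} =>
      pair_words a b A B z rel1 y) x1 ->
  has_count (fun y : {ffun 'I_m -> int} =>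
      pair_words a b A B z rel2 y) x2 ->
  has_count (fun y : {ffun 'I_m -> int} =>
      pair_words a b A B z rel y) (x1 - x2).
Proof.
move=> relP c1 c2; apply: has_count_ext (has_count_diff _ c1 c2) => [y|y [yB w r2 nz]].
  split=> [[[yB w r1 nz] n2]|[yB w r nz]];
    have [relE _] := relP _ _ (yB a) (yB b).
    by split=> //; apply/relE; split=> // r2; apply: n2.
  by have [r1 n2] := relE.1 r; split=> // -[].
by split=> //; apply: (relP _ _ (yB a) (yB b)).2.
Qed.

Hypothesis ij : (i < j)%N.
Let im := ltn_ord i.
Let jm := ltn_ord j.

Let ijn : i <> j := ord_neq ij.
Let ji : j <> i := nesym ijn.

Ltac order_keys := by rewrite /key; lia.
Ltac same_forbidden := by move=> l li lj; have := ltn_ord l; split; lia.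
Ltac solve_rel := by move=> u v uB vB; split; [move=> h; split; lia | case; lia].

(** The lemmas of this group add the two choices of signs of i and j. *)
Lemma words_equal z :
  has_count (fun y : {ffun 'I_m -> int} =>
      pair_words i j A B z (fun u v => u = v) y)
    (N z * (others_poly i j (fun l => i < l < j)%N).[N z]).
Proof.
have cp := codes_equal_pos z ij (ltnW al1) albe.
have cn := codes_equal_neg z ij (ltnW al1) albe.
have e : N z = be%:R + (al + ~~ z)%:R.
  by rewrite /N -natrD; congr (_%:R); move: al1; clear; case: z; lia.
rewrite [X in X * _]e mulrDl.
apply: (words_pair_or (rel1 := fun u v => u = v /\ 0 < u)
                       (rel2 := fun u v => u = v /\ v <= 0)); first by lia.
  apply: (words_pair ijn _ _ cp);
    [by []|order_keys|same_forbidden|solve_rel].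
apply: (words_pair_sym (rel := fun v u => u = v /\ v <= 0)).
apply: (words_pair ji _ _ cn);
    [by []|order_keys|same_forbidden|solve_rel].
Qed.

Lemma words_equal_first :
  has_count (fun y : {ffun 'I_m -> int} =>
      pair_words i j A B false (fun u v => u = v /\ v = 0) y)
    (1%:R * (others_poly i j (fun l => i < l)%N).[N false]).
Proof.
apply: (words_pair_sym (rel := fun v u => u = v /\ v = 0)).
apply: (words_pair ji _ _ (codes_equal_first ij al1 albe));
    [by []|order_keys|same_forbidden|solve_rel].
Qed.

Lemma words_equal_last_pos : be = al.+1 ->
  has_count (fun y : {ffun 'I_m -> int} =>
      pair_words i j A B false (fun u v => u = v /\ u = B%:Z) y)
    (1%:R * (others_poly i j (fun l => i < l)%N).[N false]).
Proof.
move=> ev.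
apply: (words_pair ijn _ _ (codes_equal_last_pos ij al1 ev));
    [by []|order_keys|same_forbidden|].
solve_rel.
Qed.

Lemma words_equal_last_neg : be = al ->
  has_count (fun y : {ffun 'I_m -> int} =>
      pair_words i j A B false (fun u v => u = v /\ v = - B%:Z) y)
    (1%:R * (others_poly i j (fun l => l < j)%N).[N false]).
Proof.
move=> od.
apply: (words_pair_sym (rel := fun v u => u = v /\ v = - B%:Z)).
apply: (words_pair ji _ _ (codes_equal_last_neg ij al1 od));
    [by []|order_keys|same_forbidden|solve_rel].
Qed.

Lemma words_opposite z :
  has_count (fun y : {ffun 'I_m -> int} =>
      pair_words i j A B z (fun u v => u = - v /\ u <> 0) y)
    ((al%:R + al%:R) * (others_poly i j (fun l => (i < l) + (j < l))%N).[N z]).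
Proof.
rewrite mulrDl.
apply: (words_pair_or (rel1 := fun u v => u = - v /\ 0 < u)
                       (rel2 := fun u v => u = - v /\ 0 < v)); first by lia.
  apply: (words_pair ijn _ _ (codes_opposite z ijn al1 albe));
    [by []|order_keys|same_forbidden|solve_rel].
apply: (words_pair_sym (rel := fun v u => u = - v /\ 0 < v)).
apply: (words_pair ji _ _ (codes_opposite z ji al1 albe));
    [by []|order_keys|same_forbidden|solve_rel].
Qed.

Lemma words_opposite_last : be = al ->
  has_count (fun y : {ffun 'I_m -> int} =>
      pair_words i j A B false (fun u v => u = - v /\ u = - B%:Z) y)
    (1%:R * (others_poly i j (fun l => (i < l) + (j < l) + (l < i))%N).[N false]).
Proof.
move=> od.
apply: (words_pair_sym (rel := fun v u => u = - v /\ u = - B%:Z)).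
apply: (words_pair ji _ _ (codes_opposite_last ij al1 od));
    [by []|order_keys|same_forbidden|solve_rel].
Qed.

Lemma words_succ z :
  has_count (fun y : {ffun 'I_m -> int} =>
      pair_words i j A B z (fun u v => u = v + 1 /\ v <> 0) y)
    ((be.-1%:R + (al - z)%:R) * (others_poly i j (fun l => 1 + (j < l) + (l < i))%N).[N z]).
Proof.
rewrite mulrDl.
apply: (words_pair_or (rel1 := fun u v => u = v + 1 /\ 0 < v)
                       (rel2 := fun u v => u = v + 1 /\ u <= 0)); first by lia.
  apply: (words_pair_sym (rel := fun v u => u = v + 1 /\ 0 < v)).
  apply: (words_pair ji _ _ (codes_succ_pos z ij al1 albe));
    [by []|order_keys|same_forbidden|solve_rel].
apply: (words_pair ijn _ _ (codes_succ_neg z ij al1 albe));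
    [by []|order_keys|same_forbidden|solve_rel].
Qed.

Lemma words_sum z :
  has_count (fun y : {ffun 'I_m -> int} =>
      pair_words i j A B z (fun u v => u + v = 1) y)
    (((be - z)%:R + (be - z)%:R) * (others_poly i j (fun l => (l < i) + (l < j))%N).[N z]).
Proof.
rewrite mulrDl.
apply: (words_pair_or (rel1 := fun u v => u + v = 1 /\ 0 < u)
                       (rel2 := fun u v => u + v = 1 /\ 0 < v)); first by lia.
  apply: (words_pair_sym (rel := fun v u => u + v = 1 /\ 0 < u)).
  apply: (words_pair ji _ _ (codes_sum z ijn al1 albe));
    [by []|order_keys|same_forbidden|solve_rel].
apply: (words_pair ijn _ _ (codes_sum z ji al1 albe));
    [by []|order_keys|same_forbidden|solve_rel].
Qed.

Lemma words_sum_first :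
  has_count (fun y : {ffun 'I_m -> int} =>
      pair_words i j A B false (fun u v => u + v = 1 /\ v = 0) y)
    (1%:R * (others_poly i j (fun l => 1 + (l < i))%N).[N false]).
Proof.
apply: (words_pair_sym (rel := fun v u => u + v = 1 /\ v = 0)).
apply: (words_pair ji _ _ (codes_sum_first ijn al1 albe));
    [by []|order_keys|same_forbidden|solve_rel].
Qed.

Lemma words_sum_last : be = al.+1 ->
  has_count (fun y : {ffun 'I_m -> int} =>
      pair_words i j A B false (fun u v => u + v = 1 /\ v = B%:Z) y)
    (1%:R * (others_poly i j (fun l => 1 + (l < i))%N).[N false]).
Proof.
move=> ev.
apply: (words_pair ijn _ _ (codes_sum_last ijn al1 ev));
    [by []|order_keys|same_forbidden|solve_rel].
Qed.
End Touch.

(** * New points in integer coordinates *)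

Definition hit (q : nat) (eps b : bool) (u v : int) : bool :=
  (q%:Z %| (if eps then u + v else u - v) - (b : nat)%:Z)%Z.

Lemma dvdz_small (q : nat) (t : int) : - (2 * q%:Z) < t < 2 * q%:Z ->
  (q%:Z %| t)%Z = [|| t == 0, t == q%:Z | t == - q%:Z].
Proof.
move=> tq; apply/dvdzP/idP => [[k tk]|/or3P[] /eqP->].
- have k2 : k < 2 by nia.
  have k2' : -2 < k by nia.
  have kk : k = 0 \/ k = 1 \/ k = -1 by lia.
  by case: kk tk => [->|[->|->]] ->; rewrite ?mul0r ?mul1r ?mulN1r !eqxx ?orbT.
- by exists 0; rewrite mul0r.
- by exists 1; rewrite mul1r.
- by exists (-1); rewrite mulN1r.
Qed.

(** Congruence modulo q for integers of absolute value below 2 q. *)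
Definition hit_box (q : nat) (eps b : bool) (u v : int) : bool :=
  let t := (if eps then u + v else u - v) - (b : nat)%:Z in
  [|| t == 0, t == q%:Z | t == - q%:Z].

Lemma hitE q A B eps b u v :
    q = (A + B + 1)%N -> (A <= B <= A.+1)%N -> (1 < q)%N ->
    - A%:Z <= u <= B%:Z -> - A%:Z <= v <= B%:Z ->
  hit q eps b u v = hit_box q eps b u v.
Proof.
move=> qE AB q1 uB vB; rewrite /hit dvdz_small //.
by case: eps; case: b; move: qE AB q1 uB vB; clear; lia.
Qed.

(** Of the four equations of a pair exactly the one given by eps (the sign) and
    b (the constant) holds. *)
Definition only_hit (q : nat) (eps b : bool) (u v : int) : Prop :=
  hit q eps b u v /\ forall eps' b', (eps', b') <> (eps, b) -> ~~ hit q eps' b' u v.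

(** The number of new points of x_i +- x_j = b in type D, as a polynomial in
    X = q + 4 - 2m, the number of codes after the insertion of a cell. The
    subtracted terms count the positions in which i or j lies at an end of the
    box and a second equation of the pair holds. *)
Definition new_polyD (m : nat) (i j : 'I_m) (eps b odd : bool) : {poly rat} :=
  match eps, b with
  | false, false => 'X * others_poly i j (fun l => i < l < j)%N - others_poly i j (fun l => i < l)%N
      - others_poly i j (if odd then fun l => (l < j)%N : nat else fun l => (i < l)%N : nat)
  | true, false =>
      if odd then ('X - 1%:P) * others_poly i j (fun l => (i < l) + (j < l))%N
                  - others_poly i j (fun l => (i < l) + (j < l) + (l < i))%N
      else ('X - 2%:P) * others_poly i j (fun l => (i < l) + (j < l))%N
  | false, true => ('X - 2%:P) * others_poly i j (fun l => 1 + (j < l) + (l < i))%N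
  | true, true =>
      if odd then ('X - 1%:P) * others_poly i j (fun l => (l < i) + (l < j))%N
                  - others_poly i j (fun l => 1 + (l < i))%N
      else 'X * others_poly i j (fun l => (l < i) + (l < j))%N
                  - 2%:P * others_poly i j (fun l => 1 + (l < i))%N
  end.

(** The same in type C, with X = q + 2 - 2m since the code 0 is excluded and the
    box is shorter. No second equation of the pair can hold at an end of the box. *)
Definition new_polyC (m : nat) (i j : 'I_m) (eps b odd : bool) : {poly rat} :=
  match eps, b with
  | false, false => 'X * others_poly i j (fun l => i < l < j)%N
  | true, false => (if odd then 'X - 1%:P else 'X) * others_poly i j (fun l => (i < l) + (j < l))%N
  | false, true => ('X - 2%:P) * others_poly i j (fun l => 1 + (j < l) + (l < i))%N
  | true, true => ('X - (if odd then 1 else 2)%:P) * others_poly i j (fun l => (l < i) + (l < j))%N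
  end.

Definition neg_bound (q : nat) : nat := q.-1./2.
Definition pos_bound (q : nat) : nat := q./2.

Lemma only_hitE q A B eps b u v :
    q = (A + B + 1)%N -> (A <= B <= A.+1)%N -> (1 < q)%N ->
    - A%:Z <= u <= B%:Z -> - A%:Z <= v <= B%:Z ->
  only_hit q eps b u v <->
  [&& hit_box q eps b u v, ~~ hit_box q (~~ eps) b u v,
      ~~ hit_box q eps (~~ b) u v & ~~ hit_box q (~~ eps) (~~ b) u v].
Proof.
move=> qE AB q1 uB vB; have hE e c := hitE e c qE AB q1 uB vB.
rewrite /only_hit hE; split=> [[-> n] /=|/and4P[h1 h2 h3 h4]].
  by rewrite -!hE !n //; case: (eps); case: (b).
split=> // e c; rewrite hE.
by move: h1 h2 h3 h4; case: (eps); case: (b); case: e; case: c.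
Qed.

Lemma words_pair_ext (m : nat) (i j : 'I_m) (A B : nat) (z : bool)
    (rel rel' : int -> int -> Prop) (x x' : rat) :
    x = x' ->
    (forall u v, - A%:Z <= u <= B%:Z -> - A%:Z <= v <= B%:Z ->
       (z -> u <> 0) -> (z -> v <> 0) -> rel u v <-> rel' u v) ->
  has_count (fun y : {ffun 'I_m -> int} =>
      pair_words i j A B z rel y) x ->
  has_count (fun y : {ffun 'I_m -> int} =>
      pair_words i j A B z rel' y) x'.
Proof.
move=> <- relP; apply: has_count_ext => y; split=> -[yB w r nz]; split=> //.
  by apply/(relP _ _ (yB i) (yB j)) => // h; apply: nz.
by apply/(relP _ _ (yB i) (yB j)) => // h; apply: nz.
Qed.

(** At 0 the equations x_i = x_j and x_i = - x_j hold together, and so do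
    x_i - x_j = 1 and x_i + x_j = 1 when x_j = 0. At the other end it
    depends on the parity: for even q the residue q/2 is a fixed point like 0,
    while for odd q the residue (q + 1)/2 satisfies 2 x = 1. *)
Lemma words_only_hitD (m : nat) (i j : 'I_m) (eps b : bool) (q : nat) :
    (i < j)%N -> (2 * m + 4 <= q)%N ->
  has_count (fun y : {ffun 'I_m -> int} =>
      pair_words i j (neg_bound q) (pos_bound q) false (only_hit q eps b) y)
    (new_polyD i j eps b (odd q)).[(q + 4 - 2 * m)%:R].
Proof.
move=> ij qm; have jm := ltn_ord j.
pose A := neg_bound q; pose B := pos_bound q.
pose al := (A.+1 - m.-1)%N; pose be := (B.+1 - m.-1)%N.
have q2 := odd_double_half q.
have AE : A = (if odd q then q./2 else q./2.-1).
  by rewrite /A /neg_bound; move: q2 qm; clear; case: (odd q) => /=; lia.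
have qE : q = (A + B + 1)%N.
  rewrite AE /B /pos_bound; move: q2 qm jm ij; clear; case: (odd q); lia.
have AB : (A <= B <= A.+1)%N by rewrite AE /B /pos_bound; case: (odd q); lia.
have al1 : (1 < al)%N by move: qE AB qm; rewrite /al; clear; lia.
have albe : (al <= be <= al.+1)%N by move: AB al1; rewrite /al /be; clear; lia.
have Aal : A.+1 = (al + m.-1)%N by move: al1; rewrite /al; clear; lia.
have Bbe : B.+1 = (be + m.-1)%N by move: AB al1; rewrite /al /be; clear; lia.
have tE : (q + 4 - 2 * m)%N = (al + be + 1 - false)%N.
  by move: Aal Bbe qE jm; clear; lia.
have parity : if odd q then be = al else be = al.+1.
  by move: AE Aal Bbe; rewrite /B /pos_bound; case: (odd q); lia.
have q1 : (1 < q)%N by lia.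
have ohE e c u v := @only_hitE q A B e c u v qE AB q1.
rewrite tE; set t := (al + be + 1 - false)%:R : rat.
have cE := words_equal al1 albe Aal Bbe ij false.
have cEf := words_equal_first al1 albe Aal Bbe ij.
have cO := words_opposite al1 albe Aal Bbe ij false.
have cS := words_succ al1 albe Aal Bbe ij false.
have cM := words_sum al1 albe Aal Bbe ij false.
have cMf := words_sum_first al1 albe Aal Bbe ij.
rewrite -/t in cE cEf cO cS cM cMf *.
pose P phi := (others_poly i j phi).[t].
pose pE := P (fun l => i < l < j)%N; pose pEf := P (fun l => i < l)%N.
pose pEl := P (fun l => l < j)%N.
pose pO := P (fun l => (i < l) + (j < l))%N.
pose pOl := P (fun l => (i < l) + (j < l) + (l < i))%N.
pose pM := P (fun l => (l < i) + (l < j))%N.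
pose pMf := P (fun l => 1 + (l < i))%N.
pose mu : rat := (be - false)%:R + (be - false)%:R.
have cEn : has_count (fun y : {ffun 'I_m -> int} =>
    pair_words i j A B false (fun u v => u = v /\ v <> 0) y) (t * pE - 1%:R * pEf).
  by apply: words_pair_diff cE cEf => u v _ _; clear; lia.
have cMn : has_count (fun y : {ffun 'I_m -> int} =>
    pair_words i j A B false (fun u v => u + v = 1 /\ v <> 0) y) (mu * pM - 1%:R * pMf).
  by apply: words_pair_diff cM cMf => u v _ _; clear; lia.
have tq : t = al%:R + be%:R + 1 by rewrite /t subn0 !natrD.
have B1 : (1 < B)%N by move: AB qE qm; clear; lia.
move: parity AE; rewrite -/A; case: (odd q) => par AE; have BE : B = q./2 by []; rewrite -BE in AE.
- have AeB : A = B by [].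
  have al2 : al%:R + al%:R = t - 1 :> rat by rewrite tq par; ring.
  have mut : mu = t - 1 by rewrite /mu subn0 tq par; ring.
  have su : be.-1%:R + (al - false)%:R = t - 2 :> rat.
    by rewrite tq subn0 -[be in RHS](@prednK be) -?natr1; [ring | lia].
  have cOn : has_count (fun y : {ffun 'I_m -> int} =>
      pair_words i j A B false (fun u v => u = - v /\ u <> 0 /\ u <> - B%:Z) y)
      ((al%:R + al%:R) * pO - 1%:R * pOl).
    apply: words_pair_diff cO (words_opposite_last al1 albe Aal Bbe ij par) => u v _ _.
    by move: B1; clear; lia.
  have cEl : has_count (fun y : {ffun 'I_m -> int} =>
      pair_words i j A B false (fun u v => u = v /\ v <> 0 /\ v <> - B%:Z) y)
      (t * pE - 1%:R * pEf - 1%:R * pEl).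
    apply: words_pair_diff cEn (words_equal_last_neg al1 albe Aal Bbe ij par) => u v _ _.
    by move: B1; clear; lia.
  case: eps; case: b; rewrite /new_polyD.
  + apply: words_pair_ext cMn => [|u v uB vB _ _].
      by rewrite ?al2 ?mut ?su /pE /pEf /pEl /pO /pOl /pM /pMf /P !hornerE; ring.
    rewrite ohE // /hit_box /=; move: uB vB AeB qE B1; clear; lia.
  + apply: words_pair_ext cOn => [|u v uB vB _ _].
      by rewrite ?al2 ?mut ?su /pE /pEf /pEl /pO /pOl /pM /pMf /P !hornerE; ring.
    rewrite ohE // /hit_box /=; move: uB vB AeB qE B1; clear; lia.
  + apply: words_pair_ext cS => [|u v uB vB _ _].
      by rewrite ?al2 ?mut ?su /pE /pEf /pEl /pO /pOl /pM /pMf /P !hornerE; ring.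
    rewrite ohE // /hit_box /=; move: uB vB AeB qE B1; clear; lia.
  + apply: words_pair_ext cEl => [|u v uB vB _ _].
      by rewrite ?al2 ?mut ?su /pE /pEf /pEl /pO /pOl /pM /pMf /P !hornerE; ring.
    rewrite ohE // /hit_box /=; move: uB vB AeB qE B1; clear; lia.
- have al2 : al%:R + al%:R = t - 2 :> rat by rewrite tq par -natr1; ring.
  have mut : mu = t by rewrite /mu subn0 tq par -natr1; ring.
  have su : be.-1%:R + (al - false)%:R = t - 2 :> rat.
    by rewrite tq subn0 -[be in RHS](@prednK be) -?natr1; [ring | lia].
  have AeB : B = A.+1 by move: AE B1; rewrite -/B; clear; lia.
  have cMl : has_count (fun y : {ffun 'I_m -> int} =>
      pair_words i j A B false (fun u v => u + v = 1 /\ v <> 0 /\ v <> B%:Z) y)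
      (mu * pM - 1%:R * pMf - 1%:R * pMf).
    apply: words_pair_diff cMn (words_sum_last al1 albe Aal Bbe ij par) => u v _ _.
    by move: B1; clear; lia.
  have cEl : has_count (fun y : {ffun 'I_m -> int} =>
      pair_words i j A B false (fun u v => u = v /\ v <> 0 /\ v <> B%:Z) y)
      (t * pE - 1%:R * pEf - 1%:R * pEf).
    apply: words_pair_diff cEn (words_equal_last_pos al1 albe Aal Bbe ij par) => u v _ _.
    by move: B1; clear; lia.
  case: eps; case: b; rewrite /new_polyD.
  + apply: words_pair_ext cMl => [|u v uB vB _ _].
      by rewrite ?al2 ?mut ?su /pE /pEf /pEl /pO /pOl /pM /pMf /P !hornerE; ring.
    rewrite ohE // /hit_box /=; move: uB vB AeB qE B1; clear; lia.
  + apply: words_pair_ext cO => [|u v uB vB _ _].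
      by rewrite ?al2 ?mut ?su /pE /pEf /pEl /pO /pOl /pM /pMf /P !hornerE; ring.
    rewrite ohE // /hit_box /=; move: uB vB AeB qE B1; clear; lia.
  + apply: words_pair_ext cS => [|u v uB vB _ _].
      by rewrite ?al2 ?mut ?su /pE /pEf /pEl /pO /pOl /pM /pMf /P !hornerE; ring.
    rewrite ohE // /hit_box /=; move: uB vB AeB qE B1; clear; lia.
  + apply: words_pair_ext cEl => [|u v uB vB _ _].
      by rewrite ?al2 ?mut ?su /pE /pEf /pEl /pO /pOl /pM /pMf /P !hornerE; ring.
    rewrite ohE // /hit_box /=; move: uB vB AeB qE B1; clear; lia.
Qed.

Lemma words_only_hitC (m : nat) (i j : 'I_m) (eps b : bool) (q : nat) :
    (i < j)%N -> (2 * m + 6 <= q)%N ->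
  has_count (fun y : {ffun 'I_m -> int} =>
      pair_words i j (pos_bound q).-1 (neg_bound q) true (only_hit q eps b) y)
    (new_polyC i j eps b (odd q)).[(q + 2 - 2 * m)%:R].
Proof.
move=> ij qm; have jm := ltn_ord j.
pose A := (pos_bound q).-1; pose B := neg_bound q.
pose al := (A.+1 - m.-1)%N; pose be := (B.+1 - m.-1)%N.
have q2 := odd_double_half q.
have BE : B = (if odd q then q./2 else q./2.-1).
  by rewrite /B /neg_bound; move: q2 qm; clear; case: (odd q) => /=; lia.
have AE : A = q./2.-1 by [].
have qE : q = (A + B + 2)%N.
  rewrite AE BE; move: q2 qm jm ij; clear; case: (odd q); lia.
have AB : (A <= B <= A.+1)%N by rewrite AE BE; move: qm q2; clear; case: (odd q); lia.
have al1 : (1 < al)%N by move: qE AB qm; rewrite /al; clear; lia.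
have albe : (al <= be <= al.+1)%N by move: AB al1; rewrite /al /be; clear; lia.
have Aal : A.+1 = (al + m.-1)%N by move: al1; rewrite /al; clear; lia.
have Bbe : B.+1 = (be + m.-1)%N by move: AB al1; rewrite /al /be; clear; lia.
clearbody al be.
have tE : (q + 2 - 2 * m)%N = (al + be + 1 - true)%N.
  by move: Aal Bbe qE jm; clear; lia.
have parity : if odd q then be = al.+1 else be = al.
  by move: AE BE Aal Bbe q2 qm; clear; case: (odd q); lia.
have q1 : (1 < q)%N by lia.
have qD : q = (neg_bound q + pos_bound q + 1)%N.
  by move: qE qm; rewrite /A /B /pos_bound; clear; lia.
have ABD : (neg_bound q <= pos_bound q <= (neg_bound q).+1)%N.
  by move: AB qD qm; rewrite /A /B; clear; lia.
have ohE e c u v := @only_hitE q _ _ e c u v qD ABD q1.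
have boxD u : - A%:Z <= u <= B%:Z -> - (neg_bound q)%:Z <= u <= (pos_bound q)%:Z.
  by move: ABD; rewrite /A /B; clear; lia.
rewrite tE; set t := (al + be + 1 - true)%:R : rat.
have cE := words_equal al1 albe Aal Bbe ij true.
have cO := words_opposite al1 albe Aal Bbe ij true.
have cS := words_succ al1 albe Aal Bbe ij true.
have cM := words_sum al1 albe Aal Bbe ij true.
have tq : t = al%:R + be%:R by rewrite /t addnK natrD.
have su : be.-1%:R + (al - true)%:R = t - 2 :> rat.
  have [a1 b1] : (0 < al)%N /\ (0 < be)%N by lia.
  by rewrite tq -[be.-1]subn1 !natrB //=; ring.
have B1 : (1 < B)%N by move: AB qE qm; clear; lia.
rewrite -/A -/B -/t in cE cO cS cM *.
move: parity AE BE qD; case: (odd q) => par AE BE qD.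
- have al2 : al%:R + al%:R = t - 1 :> rat by rewrite tq par -natr1; ring.
  have mut : (be - true)%:R + (be - true)%:R = t - 1 :> rat.
    by rewrite tq par subn1 /= -natr1; ring.
  have AeB : B = A.+1 by move: AE BE B1; clear; lia.
  have qB : pos_bound q = B by rewrite BE.
  rewrite qB in boxD ohE qD.
  case: eps; case: b; rewrite /new_polyC.
  + apply: words_pair_ext cM => [|u v uB vB /(_ isT) u0 /(_ isT) v0].
      by rewrite ?al2 ?mut ?su !hornerE; ring.
    rewrite ohE ?boxD // /hit_box /=; move: uB vB u0 v0 AeB qE B1; clear; lia.
  + apply: words_pair_ext cO => [|u v uB vB /(_ isT) u0 /(_ isT) v0].
      by rewrite ?al2 ?mut ?su !hornerE; ring.
    rewrite ohE ?boxD // /hit_box /=; move: uB vB u0 v0 AeB qE B1; clear; lia.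
  + apply: words_pair_ext cS => [|u v uB vB /(_ isT) u0 /(_ isT) v0].
      by rewrite ?al2 ?mut ?su !hornerE; ring.
    rewrite ohE ?boxD // /hit_box /=; move: uB vB u0 v0 AeB qE B1; clear; lia.
  + apply: words_pair_ext cE => [|u v uB vB /(_ isT) u0 /(_ isT) v0].
      by rewrite ?al2 ?mut ?su !hornerE; ring.
    rewrite ohE ?boxD // /hit_box /=; move: uB vB u0 v0 AeB qE B1; clear; lia.
- have al2 : al%:R + al%:R = t :> rat by rewrite tq par; ring.
  have mut : (be - true)%:R + (be - true)%:R = t - 2 :> rat.
    by rewrite tq -par natrB /=; [ring | lia].
  have AeB : B = A by move: AE BE B1; clear; lia.
  case: eps; case: b; rewrite /new_polyC.
  + apply: words_pair_ext cM => [|u v uB vB /(_ isT) u0 /(_ isT) v0].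
      by rewrite ?al2 ?mut ?su !hornerE; ring.
    rewrite ohE ?boxD // /hit_box /=; move: uB vB u0 v0 AeB qE B1; clear; lia.
  + apply: words_pair_ext cO => [|u v uB vB /(_ isT) u0 /(_ isT) v0].
      by rewrite ?al2 ?mut ?su !hornerE; ring.
    rewrite ohE ?boxD // /hit_box /=; move: uB vB u0 v0 AeB qE B1; clear; lia.
  + apply: words_pair_ext cS => [|u v uB vB /(_ isT) u0 /(_ isT) v0].
      by rewrite ?al2 ?mut ?su !hornerE; ring.
    rewrite ohE ?boxD // /hit_box /=; move: uB vB u0 v0 AeB qE B1; clear; lia.
  + apply: words_pair_ext cE => [|u v uB vB /(_ isT) u0 /(_ isT) v0].
      by rewrite ?al2 ?mut ?su !hornerE; ring.
    rewrite ohE ?boxD // /hit_box /=; move: uB vB u0 v0 AeB qE B1; clear; lia.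
Qed.

(** * Residues, integers and equations *)

Lemma intr_Zq_eq0 (q : nat) (z : int) : (1 < q)%N ->
  (z%:~R == 0 :> 'Z_q) = (q%:Z %| z)%Z.
Proof.
move=> q1; have nE (n : nat) : (n%:R == 0 :> 'Z_q) = (q %| n)%N.
  by rewrite -val_eqE /= val_Zp_nat.
by case: z => n; rewrite ?NegzE ?rmorphN ?oppr_eq0 /dvdz ?abszN /= -pmulrn nE.
Qed.

(** The representative of a residue nearest to 0. *)
Definition centre (q : nat) (x : 'Z_q) : int :=
  if (x <= q./2)%N then (x : nat)%:Z else (x : nat)%:Z - q%:Z.

Lemma centreK (q : nat) (x : 'Z_q) : (1 < q)%N -> (centre x)%:~R = x.
Proof.
move=> q1; have q0 : (q%:Z)%:~R = 0 :> 'Z_q by apply/eqP; rewrite intr_Zq_eq0.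
by rewrite /centre; case: ifP => _; rewrite ?rmorphB /= ?q0 ?subr0 -?pmulrn natr_Zp.
Qed.

Lemma centre_box (q : nat) (x : 'Z_q) : (1 < q)%N ->
  - (neg_bound q)%:Z <= centre x <= (pos_bound q)%:Z.
Proof.
move=> q1; have := ltn_ord x; rewrite [X in (_ < X)%N]Zp_cast // => xq.
have := odd_double_half q; have := odd_double_half q.-1.
rewrite /centre /neg_bound /pos_bound; case: ifP => h; lia.
Qed.

Lemma centre_intr (q : nat) (y : int) : (1 < q)%N ->
  - (neg_bound q)%:Z <= y <= (pos_bound q)%:Z -> centre (y%:~R : 'Z_q) = y.
Proof.
move=> q1 yb; have cb := centre_box (y%:~R : 'Z_q) q1.
have : (q%:Z %| centre (y%:~R : 'Z_q) - y)%Z.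
  by rewrite -intr_Zq_eq0 // rmorphB /= centreK // subrr.
have qE : (neg_bound q + pos_bound q < q)%N.
  have := odd_double_half q; have := odd_double_half q.-1.
  by rewrite /neg_bound /pos_bound; lia.
move: cb; move: (centre _) => c cb; rewrite dvdz_small; lia.
Qed.

Lemma card_centre (m q n : nat) (S : {set 'rV['Z_q]_m}) (P : ('I_m -> int) -> Prop) :
    (1 < q)%N ->
    (forall y : 'I_m -> int, inbox (neg_bound q) (pos_bound q) y ->
       \row_k (y k)%:~R \in S <-> P y) ->
  counted (fun y : {ffun 'I_m -> int} => inbox (neg_bound q) (pos_bound q) y /\ P y) n ->
  #|S| = n.
Proof.
move=> q1 SP c; apply: counted_card.
apply: (counted_bij (f := fun y : {ffun 'I_m -> int} => \row_k ((y k)%:~R : 'Z_q))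
   (h := fun x : 'rV['Z_q]_m => [ffun k => centre (x 0 k)])) c.
  move=> y [yB Py]; split; first by apply/SP.
  by apply/ffunP=> k; rewrite ffunE mxE centre_intr.
move=> x Sx; have xK : \row_k ((centre (x 0 k))%:~R : 'Z_q) = x.
  by apply/rowP=> k; rewrite mxE centreK.
have cB : inbox (neg_bound q) (pos_bound q) (fun k => centre (x 0 k)).
  by move=> k; apply: centre_box.
split.
  rewrite finfunE; split=> //; apply/SP => //.
  by rewrite xK.
by rewrite -[RHS]xK; apply/rowP=> k; rewrite !mxE ffunE.
Qed.

Definition shi_eq (m : nat) (eps b : bool) (i j : 'I_m) : equation m :=
  (if eps then xcoord i + xcoord j else xcoord i - xcoord j, (b : nat)%:Z).

Definition diag_eq (m : nat) (b : bool) (i : 'I_m) : equation m :=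
  (2 *: xcoord i, (b : nat)%:Z).

Definition hyp_of (m : nat) (e : equation m) : hyperplane m := hyp e.1 e.2.

Lemma sum_xcoord (m : nat) (y : 'I_m -> int) (i : 'I_m) :
  \sum_k xcoord i 0 k * y k = y i.
Proof.
rewrite (bigD1 i) //= big1 ?addr0 => [|k ki]; first by rewrite mxE !eqxx mul1r.
by rewrite mxE eqxx (negPf ki) mul0r.
Qed.

Lemma mem_equation_mod (m q : nat) (e : equation m) (y : 'I_m -> int) : (1 < q)%N ->
  (\row_k ((y k)%:~R : 'Z_q) \in equation_mod e q) =
  (q%:Z %| \sum_k e.1 0 k * y k - e.2)%Z.
Proof.
move=> q1; rewrite inE -subr_eq0 -intr_Zq_eq0 // rmorphB rmorph_sum /=.
by under [in RHS]eq_bigr do rewrite rmorphM; under eq_bigr do rewrite mxE.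
Qed.

Lemma mem_hyp_of_mod (m q : nat) (e : equation m) (y : 'I_m -> int) : (1 < q)%N ->
  (\row_k ((y k)%:~R : 'Z_q) \in hyperplane_mod (hyp_of e) q) =
  (q%:Z %| \sum_k e.1 0 k * y k - e.2)%Z.
Proof. by move=> q1; rewrite hyperplane_mod_hyp mem_equation_mod. Qed.

Lemma mem_shi_mod (m q : nat) (eps b : bool) (i j : 'I_m) (y : 'I_m -> int) :
  (1 < q)%N ->
  (\row_k ((y k)%:~R : 'Z_q) \in hyperplane_mod (hyp_of (shi_eq eps b i j)) q) =
  hit q eps b (y i) (y j).
Proof.
move=> q1; rewrite mem_hyp_of_mod // /hit /=; case: eps => /=.
  under eq_bigr do rewrite mxE mulrDl; by rewrite big_split /= !sum_xcoord.
under eq_bigr do rewrite mxE mulrDl [(- xcoord j) 0 _]mxE mulNr.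
by rewrite big_split /= sumrN !sum_xcoord.
Qed.

Lemma mem_diag_mod (m q : nat) (b : bool) (i : 'I_m) (y : 'I_m -> int) :
  (1 < q)%N ->
  (\row_k ((y k)%:~R : 'Z_q) \in hyperplane_mod (hyp_of (diag_eq b i)) q) =
  hit q true b (y i) (y i).
Proof.
move=> q1; rewrite mem_hyp_of_mod // /hit /=.
under eq_bigr do rewrite mxE -mulrA; rewrite -mulr_sumr sum_xcoord.
by rewrite mulr_natl mulr2n.
Qed.

Lemma in_bigcup_seq (T : finType) (I : Type) (s : seq I) (F : I -> {set T}) (x : T) :
  (x \in (\bigcup_(i <- s) F i)%SET) = has (fun i => x \in F i) s.
Proof.
by elim: s => [|i s IH]; rewrite ?big_nil ?inE // big_cons inE IH.
Qed.

Lemma arr_complementP (m q : nat) (A : {fset hyperplane m}) (x : 'rV['Z_q]_m) :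
  reflect (forall H, H \in A -> x \notin hyperplane_mod H q) (x \in arr_complement A q).
Proof.
rewrite /arr_complement inE in_bigcup_seq -all_predC.
by apply: (iffP allP) => h H; apply: h.
Qed.

Lemma in_fset4 (K : choiceType) (a b c d x : K) :
  (x \in [fset a; b; c; d]%fset) = [|| x == a, x == b, x == c | x == d].
Proof. by rewrite !inE -!orbA. Qed.

Lemma shiDP (m : nat) (H : hyperplane m) :
  reflect (exists (i j : 'I_m) (eps b : bool), (i < j)%N /\ H = hyp_of (shi_eq eps b i j))
    (H \in shiD m).
Proof.
apply: (iffP idP) => [/bigfcupP[i _ /bigfcupP[j /andP[_ ij]]]|[i [j [eps [b [ij ->]]]]]].
  rewrite in_fset4; case/or4P=> /eqP->.
  - by exists i, j, true, false.
  - by exists i, j, true, true.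
  - by exists i, j, false, false.
  - by exists i, j, false, true.
apply/bigfcupP; exists i; first by apply/andP; split; first exact: mem_index_enum.
apply/bigfcupP; exists j; first by apply/andP; split; first exact: mem_index_enum.
rewrite in_fset4; apply/or4P; rewrite /hyp_of /shi_eq.
by case: eps; case: b;
  [apply: Or42|apply: Or41|apply: Or44|apply: Or43]; apply/eqP.
Qed.

Lemma shiCP (m : nat) (H : hyperplane m) :
  reflect ((exists (i : 'I_m) (b : bool), H = hyp_of (diag_eq b i)) \/ H \in shiD m) (H \in shiC m).
Proof.
rewrite /shiC in_fsetU; apply: (iffP orP) => [[/bigfcupP[i _]|]|[[i [b ->]]|]]; [|by right| |by right].
  by rewrite in_fset2 => /orP[] /eqP->; left; exists i; [exists false|exists true].
left; apply/bigfcupP; exists i; first by apply/andP; split; first exact: mem_index_enum.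
by rewrite in_fset2 /hyp_of /diag_eq; case: b; rewrite /= ?eqxx ?orbT.
Qed.

(** Hyperplanes are equations up to a global sign. *)
Lemma hyp_of_inj (m : nat) (e f : equation m) : hyp_of e = hyp_of f ->
  exists s : int, [/\ s = 1 \/ s = -1, forall k, e.1 0 k = s * f.1 0 k & e.2 = s * f.2].
Proof.
case: e f => a b [a' b'] /eqP; rewrite /hyp_of /hyp eqmodE /=.
case/orP=> /eqP[-> ->]; [exists 1|exists (-1)].
  by split=> [|k|]; rewrite ?mul1r //; left.
by split=> [|k|]; rewrite ?mulN1r ?mxE //; right.
Qed.

Lemma xcoordE (m : nat) (i k : 'I_m) : xcoord i 0 k = (k == i)%:R.
Proof. by rewrite mxE eqxx. Qed.

Lemma shi_eqE (m : nat) (eps b : bool) (i j k : 'I_m) :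
  (shi_eq eps b i j).1 0 k = (k == i)%:R + (if eps then 1 else -1) * (k == j)%:R.
Proof. case: eps; rewrite /= mxE; first by rewrite !xcoordE mul1r.
by rewrite [(- xcoord j) 0 _]mxE !xcoordE mulN1r. Qed.

Lemma diag_eqE (m : nat) (b : bool) (i k : 'I_m) :
  (diag_eq b i).1 0 k = 2 * (k == i)%:R.
Proof. by rewrite mxE xcoordE. Qed.

Lemma hyp_shi_inj (m : nat) (eps b eps' b' : bool) (i j i' j' : 'I_m) :
    (i < j)%N -> (i' < j')%N ->
    hyp_of (shi_eq eps b i j) = hyp_of (shi_eq eps' b' i' j') ->
  [/\ i = i', j = j', eps = eps' & b = b'].
Proof.
move=> ij ij' /hyp_of_inj[s [s1 hs /= hb]].
have := hs i; have := hs j; have := hs i'; have := hs j'.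
rewrite !shi_eqE !eqxx !natz -!val_eqE /=.
have -> : (j == i :> nat) = false by lia.
have -> : (i == j :> nat) = false by lia.
have -> : (j' == i' :> nat) = false by lia.
have -> : (i' == j' :> nat) = false by lia.
move=> hj' hi' hj hi.
have [e1 e2] : i = i' :> nat /\ j = j' :> nat.
  by move: hi hj hi' hj' s1 ij ij'; clear; case: (eps); case: (eps'); case=> ? *; nia.
move: hi hj; rewrite e1 e2 !eqxx => hi hj.
split; [exact: val_inj|exact: val_inj| |].
  by move: hi hj s1; clear; case: (eps); case: (eps') => // ? ? []; lia.
have {}hb : (b : nat)%:Z = (b' : nat)%:Z by move: hi hb s1; clear; case=> ? ? []; lia.
by move: hb; case: (b); case: (b').
Qed.

Lemma hyp_shi_diag (m : nat) (eps b b' : bool) (i j i' : 'I_m) :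
  (i < j)%N -> hyp_of (shi_eq eps b i j) <> hyp_of (diag_eq b' i').
Proof.
move=> ij /hyp_of_inj[s [s1 /(_ i) + _]].
rewrite shi_eqE diag_eqE eqxx !natz -!val_eqE /=.
have -> : (i == j :> nat) = false by lia.
by case: s1 => -> ; lia.
Qed.

Lemma hyp_diag_inj (m : nat) (b b' : bool) (i i' : 'I_m) :
  hyp_of (diag_eq b i) = hyp_of (diag_eq b' i') -> i = i' /\ b = b'.
Proof.
move=> /hyp_of_inj[s [s1 /(_ i) + /= hb]].
rewrite !diag_eqE eqxx !natz; have [->|_] := eqVneq i i'; last by case: s1 => ->; lia.
by move=> h; split=> //; move: hb; case: (b); case: (b') => //; case: s1; lia.
Qed.

(** * Complements and new points *)

Lemma lift_bounds (q : nat) : (1 < q)%N ->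
  [/\ q = (neg_bound q + pos_bound q + 1)%N, (neg_bound q <= pos_bound q <= (neg_bound q).+1)%N &
   if odd q then pos_bound q = neg_bound q else pos_bound q = (neg_bound q).+1].
Proof.
move=> q1; have := odd_double_half q; have := odd_double_half q.-1.
rewrite /neg_bound /pos_bound; case: (boolP (odd q)) => oq; case: (odd q.-1); split; lia.
Qed.

(** The solutions modulo q with y_i +- y_j - b = q or - q are also solutions of
    another equation of the pair over the integers; so the four conditions
    together are the same modulo q and over the integers. *)
Lemma no_hitP (q : nat) (u v : int) : (1 < q)%N ->
    - (neg_bound q)%:Z <= u <= (pos_bound q)%:Z -> - (neg_bound q)%:Z <= v <= (pos_bound q)%:Z ->
  (forall eps b, ~~ hit q eps b u v) <-> [/\ u <> v, u + v <> 0, u - v <> 1 & u + v <> 1].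
Proof.
move=> q1 uB vB; have [qE AB _] := lift_bounds q1.
have hE eps b := hitE eps b qE AB q1 uB vB.
split=> [no|[n1 n2 n3 n4] eps b].
  have := no true true; have := no true false; have := no false true; have := no false false.
  rewrite !hE /hit_box /=; move: (neg_bound q) (pos_bound q) qE AB q1 uB vB => A B; clear.
  by move=> *; split; lia.
rewrite hE /hit_box; move: n1 n2 n3 n4; move: (neg_bound q) (pos_bound q) qE AB q1 uB vB => A B.
by case: eps; case: b; clear; lia.
Qed.

(** The solutions of 2 x = 0 and 2 x = 1 are 0 and, according to the parity of q,
    one of the two ends of the box. *)
Lemma diag_missP (q : nat) (u : int) : (3 < q)%N ->
    - (neg_bound q)%:Z <= u <= (pos_bound q)%:Z ->
  (forall b, ~~ hit q true b u u) <->
  u <> 0 /\ - (pos_bound q).-1%:Z <= u <= (neg_bound q)%:Z.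
Proof.
move=> q3 uB; have q1 : (1 < q)%N by lia.
have [qE AB par] := lift_bounds q1.
have hE b := hitE true b qE AB q1 uB uB.
split=> [no|[n1 n2] b].
  have := no true; have := no false.
  rewrite !hE /hit_box /=; move: (neg_bound q) (pos_bound q) qE AB q3 uB par => A B; clear.
  by case: (odd q) => *; split; lia.
rewrite hE /hit_box; move: n1 n2; move: (neg_bound q) (pos_bound q) qE AB q3 uB par => A B.
by case: b; clear; case: (odd q); lia.
Qed.

Lemma word_butP (m : nat) (i j : 'I_m) (y : 'I_m -> int) : (i < j)%N ->
  word_but i j y <->
  forall i' j' : 'I_m, (i' < j')%N -> (i', j') <> (i, j) -> pair_ok y i' j'.
Proof.
move=> ij; split=> [w i' j' ij' ne|ok a b ab n1 n2].
  apply/(pair_okP y ij'); split; apply: w.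
  - exact: ord_neq.
  - by case=> e1 e2; apply: ne; rewrite e1 e2.
  - by case=> e1 e2; move: ij'; rewrite e1 e2; lia.
  - by apply: nesym; apply: ord_neq.
  - by case=> e1 e2; move: ij'; rewrite e1 e2; lia.
  - by case=> e1 e2; apply: ne; rewrite e1 e2.
have [lt|lt|/val_inj//] := ltngtP a b.
  by have /(pair_okP y lt)[] := ok a b lt (fun e => n1 (conj (congr1 fst e) (congr1 snd e))).
by have /(pair_okP y lt)[] := ok b a lt (fun e => n2 (conj (congr1 snd e) (congr1 fst e))).
Qed.

Definition new_points (m q : nat) (A : {fset hyperplane m}) (H : hyperplane m) :
    {set 'rV['Z_q]_m} :=
  (hyperplane_mod H q :&: arr_complement (A `\ H)%fset q)%SET.

Lemma card_deletion (m q : nat) (A : {fset hyperplane m}) (H : hyperplane m) :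
  H \in A ->
  #|arr_complement (A `\ H)%fset q| = (#|arr_complement A q| + #|new_points q A H|)%N.
Proof.
move=> HA; rewrite -(cardsID (hyperplane_mod H q)) addnC; congr (_ + _)%N.
  apply: eq_card => x; rewrite inE; apply/andP/arr_complementP => [[xH /arr_complementP xA] H' H'A|xA].
    by have [->//|ne] := eqVneq H' H; apply: xA; rewrite in_fsetD1 ne.
  split; first exact: xA.
  by apply/arr_complementP=> H'; rewrite in_fsetD1 => /andP[_]; apply: xA.
by apply: eq_card => x; rewrite !inE andbC.
Qed.

Lemma mem_complementD (m q : nat) (y : 'I_m -> int) : (1 < q)%N ->
    inbox (neg_bound q) (pos_bound q) y ->
  (\row_k ((y k)%:~R : 'Z_q) \in arr_complement (shiD m) q) <-> word y.
Proof.
move=> q1 yB; split=> [/arr_complementP no|/word_pair_ok ok].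
  apply/word_pair_ok => i j ij; apply/(no_hitP q1 (yB i) (yB j)) => eps b.
  by rewrite -mem_shi_mod //; apply: no; apply/shiDP; exists i, j, eps, b.
apply/arr_complementP=> H /shiDP[i [j [eps [b [ij ->]]]]].
by rewrite mem_shi_mod //; have /(no_hitP q1 (yB i) (yB j)) := ok i j ij.
Qed.

Lemma mem_complementC (m q : nat) (y : 'I_m -> int) : (3 < q)%N ->
    inbox (neg_bound q) (pos_bound q) y ->
  (\row_k ((y k)%:~R : 'Z_q) \in arr_complement (shiC m) q) <->
  [/\ inbox (pos_bound q).-1 (neg_bound q) y, word y & forall k, y k <> 0].
Proof.
move=> q3 yB; have q1 : (1 < q)%N by lia.
have -> : (\row_k ((y k)%:~R : 'Z_q) \in arr_complement (shiC m) q) <->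
   (forall k b, ~~ hit q true b (y k) (y k)) /\
   (\row_k ((y k)%:~R : 'Z_q) \in arr_complement (shiD m) q).
  split=> [/arr_complementP no|[dm /arr_complementP no]].
    split; last by apply/arr_complementP=> H HD; apply: no; apply/shiCP; right.
    by move=> k b; rewrite -mem_diag_mod //; apply: no; apply/shiCP; left; exists k, b.
  apply/arr_complementP=> H /shiCP[[k [b ->]]|]; last exact: no.
  by rewrite mem_diag_mod.
rewrite (mem_complementD q1 yB); split=> [[dm w]|[yC w nz]].
  by split=> // k; have [] := (diag_missP q3 (yB k)).1 (dm k).
by split=> // k; apply/(diag_missP q3 (yB k)); split.
Qed.

Lemma mem_new_pointsD (m q : nat) (eps b : bool) (i j : 'I_m) (y : 'I_m -> int) :
    (1 < q)%N -> (i < j)%N -> inbox (neg_bound q) (pos_bound q) y ->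
  (\row_k ((y k)%:~R : 'Z_q) \in new_points q (shiD m) (hyp_of (shi_eq eps b i j))) <->
  pair_words i j (neg_bound q) (pos_bound q) false (only_hit q eps b) y.
Proof.
move=> q1 ij yB; rewrite inE mem_shi_mod //.
split=> [/andP[hH /arr_complementP no]|[_ /(word_butP y ij) w [hH oth] _]].
  have miss (i' j' : 'I_m) (eps' b' : bool) : (i' < j')%N -> (i', j', eps', b') <> (i, j, eps, b) ->
      ~~ hit q eps' b' (y i') (y j').
    move=> ij' ne; rewrite -mem_shi_mod //; apply: no; rewrite in_fsetD1; apply/andP; split.
      by apply/eqP=> /(hyp_shi_inj ij' ij)[e1 e2 e3 e4]; apply: ne; rewrite e1 e2 e3 e4.
    by apply/shiDP; exists i', j', eps', b'.
  split=> //; last by split=> // eps' b' ne; apply: miss => // -[? ?]; apply: ne; congr pair.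
  apply/(word_butP y ij) => i' j' ij' ne; apply/(no_hitP q1 (yB i') (yB j')) => eps' b'.
  by apply: miss => // -[? ? _ _]; apply: ne; congr pair.
rewrite hH; apply/arr_complementP=> H; rewrite in_fsetD1 => /andP[/eqP ne /shiDP].
case=> i' [j' [eps' [b' [ij' eH]]]]; rewrite eH mem_shi_mod //.
have [[e1 e2]|/eqP nij] := eqVneq (i', j') (i, j).
  by rewrite e1 e2; apply: oth => -[e3 e4]; apply: ne; rewrite eH e1 e2 e3 e4.
by have /(no_hitP q1 (yB i') (yB j')) := w i' j' ij' nij.
Qed.

Lemma mem_new_pointsC (m q : nat) (eps b : bool) (i j : 'I_m) (y : 'I_m -> int) :
    (3 < q)%N -> (i < j)%N -> inbox (neg_bound q) (pos_bound q) y ->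
  (\row_k ((y k)%:~R : 'Z_q) \in new_points q (shiC m) (hyp_of (shi_eq eps b i j))) <->
  pair_words i j (pos_bound q).-1 (neg_bound q) true (only_hit q eps b) y.
Proof.
move=> q3 ij yB; have q1 : (1 < q)%N by lia.
have -> : (\row_k ((y k)%:~R : 'Z_q) \in new_points q (shiC m) (hyp_of (shi_eq eps b i j))) <->
   (forall k b, ~~ hit q true b (y k) (y k)) /\
   (\row_k ((y k)%:~R : 'Z_q) \in new_points q (shiD m) (hyp_of (shi_eq eps b i j))).
  rewrite !in_setI; split=> [/andP[hH /arr_complementP no]|[dm /andP[hH /arr_complementP no]]].
    split; last first.
      rewrite hH; apply/arr_complementP=> H; rewrite in_fsetD1 => /andP[ne HD].
      by apply: no; rewrite in_fsetD1 ne; apply/shiCP; right.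
    move=> k c; rewrite -mem_diag_mod //; apply: no; rewrite in_fsetD1.
    apply/andP; split; last by apply/shiCP; left; exists k, c.
    by apply/eqP=> /esym; apply: hyp_shi_diag.
  rewrite hH; apply/arr_complementP=> H; rewrite in_fsetD1 => /andP[ne].
  case/shiCP=> [[k [c ->]]|HD]; first by rewrite mem_diag_mod.
  by apply: no; rewrite in_fsetD1 ne.
rewrite (mem_new_pointsD eps b q1 ij yB); split=> [[dm [_ w r _]]|[yC w r nz]].
  by split=> // [k|_ k]; have [] := (diag_missP q3 (yB k)).1 (dm k).
by split; [move=> k; apply/(diag_missP q3 (yB k)); split; auto | split].
Qed.

(** * Numbers of points *)

Lemma counted_alphabet (m a b : nat) (z : bool) :
  counted (fun g : {ffun 'I_m -> int} => inbox a b g /\ (z -> forall l, g l <> 0))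
    ((a + b + 1 - z) ^ m)%N.
Proof.
have -> : ((a + b + 1 - z) ^ m = \prod_(l < m) size (alphabet z a b))%N.
  by rewrite prod_nat_const card_ord size_alphabet.
apply: counted_ext (counted_family (A := fun _ : 'I_m => alphabet z a b) _).
  move=> g; split=> [gA|[gb nz] l].
    by split=> [l|zT l]; have := gA l; rewrite mem_alphabet => /andP[] // /implyP/(_ zT)/eqP.
  rewrite mem_alphabet gb andbT; apply/implyP=> zT; apply/eqP; exact: nz.
by move=> _; rewrite nonzeroz_uniq // intervalz_uniq.
Qed.

Lemma counted_all_words (m A B : nat) (z : bool) : (0 < m)%N ->
    (m.-1 <= A)%N -> (A <= B <= A.+1)%N ->
  counted (fun y : {ffun 'I_m -> int} => [/\ inbox A B y, word y & z -> forall l, y l <> 0])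
    ((A + B + 3 - 2 * m - z) ^ m)%N.
Proof.
move=> m0 mA AB; pose a := (A - m.-1)%N; pose b := (B - m.-1)%N.
have ab : (a <= b <= a.+1)%N by rewrite /a /b; lia.
have := counted_words (R := fun y => z -> forall l, y l <> 0)
   (R' := fun g => z -> forall l, g l <> 0) ab _ (counted_alphabet m a b z).
have -> : (a + m.-1 = A)%N by rewrite /a; lia.
have -> : (b + m.-1 = B)%N by rewrite /b; lia.
have -> : (a + b + 1 - z = A + B + 3 - 2 * m - z)%N by rewrite /a /b; lia.
apply=> g _; have w := spread_word g.
split=> h zT l e.
  have [p sp] := (squeeze_zero w).1 (ex_intro _ l (etrans (spreadK g l) e)).
  exact: h zT p sp.
have [p gp] := (squeeze_zero w).2 (ex_intro _ l e).
by apply: (h zT p); rewrite -gp spreadK.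
Qed.

Lemma card_complementD (m q : nat) : (0 < m)%N -> (2 * m + 4 <= q)%N ->
  #|arr_complement (shiD m) q| = ((q + 2 - 2 * m) ^ m)%N.
Proof.
move=> m0 qm; have q1 : (1 < q)%N by lia.
have [qE AB _] := lift_bounds q1.
apply: (card_centre q1 (fun y => mem_complementD q1 (y := y))).
have -> : (q + 2 - 2 * m = neg_bound q + pos_bound q + 3 - 2 * m - false)%N by lia.
apply: counted_ext (counted_all_words false m0 _ AB); last by lia.
by move=> y; split=> [[]|[]].
Qed.

Lemma lift_boundsC (q : nat) : (3 < q)%N ->
  [/\ q = ((pos_bound q).-1 + neg_bound q + 2)%N,
      ((pos_bound q).-1 <= neg_bound q <= (pos_bound q).-1.+1)%N
    & (0 < pos_bound q)%N].
Proof.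
move=> q3; have [qE AB par] := lift_bounds (ltn_trans (isT : 1 < 3)%N q3).
by move: qE AB par q3; clear; case: (odd q) => *; split; lia.
Qed.

Lemma inboxCD (m q : nat) (y : 'I_m -> int) :
  (3 < q)%N -> inbox (pos_bound q).-1 (neg_bound q) y -> inbox (neg_bound q) (pos_bound q) y.
Proof. by move=> q3 yC l; have := yC l; have [] := lift_boundsC q3; lia. Qed.

Lemma card_complementC (m q : nat) : (0 < m)%N -> (2 * m + 6 <= q)%N ->
  #|arr_complement (shiC m) q| = ((q - 2 * m) ^ m)%N.
Proof.
move=> m0 qm; have q3 : (3 < q)%N by lia.
have q1 : (1 < q)%N by lia.
have [qE AB p0] := lift_boundsC q3.
apply: (card_centre q1 (fun y => mem_complementC q3 (y := y))).
have -> : (q - 2 * m = (pos_bound q).-1 + neg_bound q + 3 - 2 * m - true)%N by lia.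
apply: counted_ext (counted_all_words true m0 _ AB); last by lia.
move=> y; split=> [[yC w /(_ isT) nz]|[_ [yC w nz]]]; last by split.
by split; [exact: inboxCD|split].
Qed.

Lemma card_new_pointsD (m q : nat) (eps b : bool) (i j : 'I_m) :
    (i < j)%N -> (2 * m + 4 <= q)%N ->
  #|new_points q (shiD m) (hyp_of (shi_eq eps b i j))|%:R =
  (new_polyD i j eps b (odd q)).[(q + 4 - 2 * m)%:R].
Proof.
move=> ij qm; have q1 : (1 < q)%N by lia.
have [n cn <-] := words_only_hitD eps b ij qm; congr (_%:R).
apply: (card_centre q1 (fun y => mem_new_pointsD eps b q1 ij (y := y))).
by apply: counted_ext cn => y; split=> [h|[]//]; split=> //; case: h.
Qed.

Lemma card_new_pointsC (m q : nat) (eps b : bool) (i j : 'I_m) :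
    (i < j)%N -> (2 * m + 6 <= q)%N ->
  #|new_points q (shiC m) (hyp_of (shi_eq eps b i j))|%:R =
  (new_polyC i j eps b (odd q)).[(q + 2 - 2 * m)%:R].
Proof.
move=> ij qm; have q3 : (3 < q)%N by lia.
have q1 : (1 < q)%N by lia.
have [n cn <-] := words_only_hitC eps b ij qm; congr (_%:R).
apply: (card_centre q1 (fun y => mem_new_pointsC eps b q3 ij (y := y))).
apply: counted_ext cn => y; split=> [h|[]//]; split=> //.
by case: h => yC _ _ _; apply: inboxCD.
Qed.

Lemma mem_new_points_diag (m q : nat) (b : bool) (i : 'I_m) (y : 'I_m -> int) :
    (1 < q)%N -> inbox (neg_bound q) (pos_bound q) y ->
  (\row_k ((y k)%:~R : 'Z_q) \in new_points q (shiC m) (hyp_of (diag_eq b i))) <->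
  [/\ hit q true b (y i) (y i),
      forall (k : 'I_m) (c : bool), (k, c) <> (i, b) -> ~~ hit q true c (y k) (y k)
    & word y].
Proof.
move=> q1 yB; rewrite in_setI mem_diag_mod //; split=> [/andP[hH /arr_complementP no]|[hH oth w]].
  split=> //.
    move=> k c ne; rewrite -mem_diag_mod //; apply: no; rewrite in_fsetD1; apply/andP; split.
      by apply/eqP=> /hyp_diag_inj[e1 e2]; apply: ne; rewrite e1 e2.
    by apply/shiCP; left; exists k, c.
  apply/(mem_complementD q1 yB)/arr_complementP=> H HD; apply: no; rewrite in_fsetD1.
  apply/andP; split; last by apply/shiCP; right.
  by apply/eqP=> e; move: HD; rewrite e => /shiDP[k [l [eps [c [kl /esym]]]]]; apply: hyp_shi_diag.
rewrite hH; apply/arr_complementP=> H; rewrite in_fsetD1 => /andP[/eqP ne].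
case/shiCP=> [[k [c e]]|]; last first.
  by move: H {ne}; apply/arr_complementP; apply/(mem_complementD q1 yB).
by rewrite e mem_diag_mod //; apply: oth => -[e1 e2]; apply: ne; rewrite e e1 e2.
Qed.

Definition off_zero (m q : nat) (i : 'I_m) : {set 'rV['Z_q]_m} :=
  [set x : 'rV['Z_q]_m | x 0 i != 0]%SET.

(** A vector with entry v at i and small even entries, far from each other, at all
    other places. *)
Definition sparse_point (m : nat) (i : 'I_m) (v : int) (k : 'I_m) : int :=
  if k == i then v else (2 * k.+1)%N%:Z.

(** If q is even, 2 x_i = 0 has the solution q/2, and if q is odd, 2 x_i = 1 has
    the solution (q + 1)/2; neither is 0, and the other coordinates can be chosen
    so as to avoid everything else. *)
Lemma new_points_diag_exist (m q : nat) (b : bool) (i : 'I_m) :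
    (8 * m + 8 <= q)%N -> odd q = b ->
  (0 < #|(new_points q (shiC m) (hyp_of (diag_eq b i)) :&: off_zero q i)%SET|)%N.
Proof.
move=> qm ob; have q1 : (1 < q)%N by lia.
have [qE AB par] := lift_bounds q1; rewrite ob in par.
pose v : int := if b then - (pos_bound q)%:Z else (pos_bound q)%:Z.
pose y := sparse_point i v.
have yE k : y k = v \/ y k = (2 * k.+1)%N%:Z by rewrite /y /sparse_point; case: ifP; auto.
have yi : y i = v by rewrite /y /sparse_point eqxx.
have yn k : k <> i -> y k = (2 * k.+1)%N%:Z by move/eqP/negPf; rewrite /y /sparse_point => ->.
have yB : inbox (neg_bound q) (pos_bound q) y.
  move=> k; have := ltn_ord k; case: (yE k) => ->; rewrite /v; move: qE AB qm par; clear.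
    by case: b; lia.
  by lia.
have hE c k := hitE true c qE AB q1 (yB k) (yB k).
apply/card_gt0P; exists (\row_k ((y k)%:~R : 'Z_q)); rewrite in_setI; apply/andP; split.
  apply/(mem_new_points_diag b i q1 yB); split.
  - rewrite hE yi /hit_box /v; move: qE AB qm par; clear; case: b; lia.
  - move=> k c ne; rewrite hE /hit_box; have km := ltn_ord k.
    have [eki|/eqP nki] := eqVneq k i.
      have {}ne : c <> b by move=> e; apply: ne; rewrite eki e.
      rewrite eki yi /v; move: ne qE AB qm par; clear.
      by case: b; case: c => // _; lia.
    rewrite yn //; move: qE AB qm km; clear; case: c; lia.
  - apply/word_pair_ok => k l kl; have km := ltn_ord k; have lm := ltn_ord l.
    have [eki|/eqP nki] := eqVneq k i.
      have li : l <> i by move=> e; move: kl; rewrite eki e ltnn.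
      rewrite /pair_ok eki yi (yn l li) /v; move: qE AB qm par lm; clear; case: b => *; split; lia.
    have [eli|/eqP nli] := eqVneq l i.
      rewrite /pair_ok eli yi (yn k nki) /v; move: qE AB qm par km; clear; case: b => *; split; lia.
    rewrite /pair_ok (yn k nki) (yn l nli); move: kl; clear => *; split; lia.
rewrite inE mxE intr_Zq_eq0 // yi dvdz_small /v.
  by move: qE AB qm par; clear; case: b; lia.
by move: qE AB qm par; clear; case: b; lia.
Qed.

Lemma new_points_diag_none (m q : nat) (i : 'I_m) : (3 < q)%N -> odd q = false ->
  #|new_points q (shiC m) (hyp_of (diag_eq true i))| = 0%N.
Proof.
move=> q3 oq; have q1 : (1 < q)%N by lia.
apply: (card_centre q1 (fun y => mem_new_points_diag true i q1 (y := y))).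
have [qE AB par] := lift_bounds q1; rewrite oq in par.
apply: counted_none => y [yB [+ _ _]].
rewrite (hitE true true qE AB q1 (yB i) (yB i)) /hit_box.
by move: (yB i) qE AB par; clear; lia.
Qed.

(** If i is in cell 0, the run of that cell is nonpositive, begins with -i and
    increases, hence contains -l only for l < i. *)
Lemma counted_zero_word (m A B : nat) (i : 'I_m) :
    (m.-1 <= A)%N -> (A <= B <= A.+1)%N ->
  counted (fun y : {ffun 'I_m -> int} => [/\ inbox A B y, word y & y i = 0])
    (\prod_(l | l != i) (A + B + 3 - 2 * m - (i < l)))%N.
Proof.
move=> mA AB; have im := ltn_ord i; pose a := (A - m.-1)%N; pose b := (B - m.-1)%N.
have ab : (a <= b <= a.+1)%N by rewrite /a /b; lia.
pose F (l : 'I_m) := if l == i then [:: 0] else alphabet (i < l)%N a b.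
have uF l : uniq (F l).
  by rewrite /F; case: ifP => // _; rewrite nonzeroz_uniq // intervalz_uniq.
have -> : (\prod_(l | l != i) (A + B + 3 - 2 * m - (i < l)) = \prod_l size (F l))%N.
  rewrite [RHS](bigD1 i) //= {1}/F eqxx mul1n; apply: eq_bigr => l li.
  by rewrite /F (negPf li) size_alphabet; congr (_ - _)%N; rewrite /a /b; lia.
have -> : A = (a + m.-1)%N by rewrite /a; lia.
have -> : B = (b + m.-1)%N by rewrite /b; lia.
apply: (counted_words (R := fun y => y i = 0)
  (R' := fun g => g i = 0 /\ forall l, ~~ prec g l i) ab).
  move=> g _; rewrite -rank_first; have := abs_spread g i; clear.
  by move=> e; split=> [h|[h1 h2]]; [split|]; lia.
apply: counted_ext (counted_family uF) => g; split=> [gF|[gb [gi no]] l].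
  have gi : g i = 0 by have := gF i; rewrite /F eqxx inE => /eqP.
  split.
    move=> l; have := gF l; rewrite /F; case: ifP => [/eqP -> _|_]; first by rewrite gi; lia.
    by rewrite mem_alphabet => /andP[].
  split=> // l; have := gF l; rewrite /F; case: ifP => [/eqP -> _|li]; first by rewrite prec_irr.
  rewrite mem_alphabet /prec /skey /key gi ltxx => /andP[+ _].
  move: li => /eqP li; have lin : l <> i :> nat by move/val_inj.
  have := ltn_ord l; move: im lin; move: (g l) => x; clear.
  by case: ltrP; case: (ltnP i l) => /= *; lia.
rewrite /F; have [->|/eqP li] := eqVneq l i; first by rewrite gi inE.
rewrite mem_alphabet gb andbT; apply/implyP=> il; apply/negP=> /eqP gl.
by have := no l; rewrite /prec /skey /key gi gl ltxx; have := ltn_ord l; move: il im; clear; lia.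
Qed.

(** The new points of 2 x_i = 0 with x_i = 0 have one polynomial count for both
    parities; the solution q/2 is extra. *)
Lemma card_new_points_zero (m q : nat) (i : 'I_m) : (2 * m + 6 <= q)%N ->
  #|(new_points q (shiC m) (hyp_of (diag_eq false i)) :\: off_zero q i)%SET| =
  (\prod_(l | l != i) (q + 1 - 2 * m - (i < l)))%N.
Proof.
move=> qm; have q3 : (3 < q)%N by lia.
have q1 : (1 < q)%N by lia.
have [qE AB p0] := lift_boundsC q3; have im := ltn_ord i.
apply: (card_centre (P := fun y => [/\ inbox (pos_bound q).-1 (neg_bound q) y, word y & y i = 0]) q1).
  move=> y yB; rewrite in_setD inE mxE negbK intr_Zq_eq0 //.
  have [qD ABD par] := lift_bounds q1.
  have -> : (q%:Z %| y i)%Z = (y i == 0).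
    by rewrite dvdz_small; have := yB i; move: qD ABD qm; clear; lia.
  split=> [/andP[/eqP yi /(mem_new_points_diag false i q1 yB)[_ oth w]]|[yC w yi]].
    split=> // k; have [->|/eqP ki] := eqVneq k i; first by rewrite yi; lia.
    by have [] := (diag_missP q3 (yB k)).1 (fun c => oth k c (fun e => ki (congr1 fst e))).
  rewrite yi eqxx; apply/(mem_new_points_diag false i q1 yB); split=> //.
    by rewrite yi /hit /= addr0 subr0 dvdz0.
  move=> k c ne; have [eki|/eqP ki] := eqVneq k i.
    have -> : c = true by case: c ne => // ne; case: ne; rewrite eki.
    rewrite eki yi (hitE true true qD ABD q1); rewrite /hit_box; move: qD qm im; clear; lia.
  apply: (diag_missP q3 (yB k)).2; split=> // yk.
  by have [] := w k i ki; rewrite yi yk.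
have -> : (q + 1 - 2 * m = (pos_bound q).-1 + neg_bound q + 3 - 2 * m)%N by lia.
apply: counted_ext (counted_zero_word i _ AB) => [y|]; last by lia.
by split=> [[yC w yi]|[]//]; split; [exact: inboxCD|split].
Qed.

Lemma new_points_zero_odd (m q : nat) (i : 'I_m) : (3 < q)%N -> odd q ->
  #|(new_points q (shiC m) (hyp_of (diag_eq false i)) :&: off_zero q i)%SET| = 0%N.
Proof.
move=> q3 oq; have q1 : (1 < q)%N by lia.
apply: (card_centre (P := fun _ => False) q1); last by apply: counted_none => y [].
move=> y yB; split=> //; rewrite in_setI => /andP[/(mem_new_points_diag false i q1 yB)[+ _ _]].
have [qD ABD par] := lift_bounds q1; rewrite oq in par.
rewrite inE mxE intr_Zq_eq0 // (hitE true false qD ABD q1 (yB i) (yB i)) /hit_box dvdz_small.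
  by have := yB i; move: qD par q3; clear; lia.
by have := yB i; move: qD par q3; clear; lia.
Qed.

(** * Comparing the two parities *)

Lemma eq_poly_parity (p r : {poly rat}) (b : bool) (q0 : nat) :
  (forall q, (q0 <= q)%N -> odd q = b -> p.[q%:R] = r.[q%:R]) -> p = r.
Proof.
move=> pr; apply/eqP; rewrite -subr_eq0; apply/negPn/negP => nz.
pose s := [seq (b + (q0 + k).*2)%N%:R : rat | k <- iota 0 (size (p - r))].
have /(_ s) := max_poly_roots nz; rewrite /s size_map size_iota ltnn.
move=> h; have : false; last by [].
apply: h; last first.
  rewrite map_inj_uniq ?iota_uniq // => k l /eqP; rewrite eqr_nat => /eqP; lia.
apply/allP=> _ /mapP[k _ ->]; apply/rootP; rewrite !hornerE pr ?subrr //.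
  by lia.
by rewrite oddD odd_double addbF oddb.
Qed.

(** A polynomial that is right for all large q agrees with each of pe and po at
    infinitely many places. *)
Lemma is_polynomial_iff (m : nat) (A : {fset hyperplane m}) (pe po : {poly rat}) (q1 : nat) :
    (forall q, (q1 <= q)%N ->
       #|arr_complement A q|%:R = (if odd q then po else pe).[q%:R]) ->
  char_quasipoly_is_polynomial A <-> pe = po.
Proof.
move=> cA; split=> [[f [q0 fA]]|e].
  have fE b q : (q0 + q1 + 2 <= q)%N -> odd q = b -> f.[q%:R] = (if b then po else pe).[q%:R].
    by move=> hq <-; rewrite -fA ?cA //; lia.
  by rewrite -(eq_poly_parity (fE false)) -(eq_poly_parity (fE true)).
by exists po, q1 => q _ hq; rewrite cA // e; case: ifP.
Qed.

Lemma not_polynomial (m : nat) (A : {fset hyperplane m}) (p : {poly rat}) (E : nat -> nat)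
    (b : bool) (q1 : nat) :
    (forall q, (q1 <= q)%N -> #|arr_complement A q|%:R = p.[q%:R] + (E q)%:R) ->
    (forall q, (q1 <= q)%N -> odd q = b -> E q = 0%N) ->
    (forall q, (q1 <= q)%N -> odd q = ~~ b -> (0 < E q)%N) ->
  ~ char_quasipoly_is_polynomial A.
Proof.
move=> cA E0 E1 [f [q0 fA]].
have fp : f = p.
  apply: (@eq_poly_parity _ _ b (q0 + q1 + 2)) => q hq oq.
  by rewrite -fA ?cA ?E0 ?addr0 //; lia.
pose q := (~~ b + (q0 + q1 + 2).*2)%N.
have oq : odd q = ~~ b by rewrite oddD odd_double addbF oddb.
have hq : (q1 <= q)%N by rewrite /q; lia.
have := E1 q hq oq; have := fA q; rewrite cA // fp => h.
have /eqP : p.[q%:R] + (E q)%:R = p.[q%:R] by apply: h; rewrite /q; lia.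
by rewrite -subr_eq0 addrC addKr pnatr_eq0 => /eqP ->.
Qed.

Definition shift_poly (x : rat) : {poly rat} := 'X + x%:P.

Lemma comp_shift_poly_inj (x : rat) (p r : {poly rat}) :
  p \Po shift_poly x = r \Po shift_poly x -> p = r.
Proof.
move=> e; rewrite -[p](comp_polyXaddC_K _ x) -[r](comp_polyXaddC_K _ x).
by rewrite /shift_poly in e; rewrite e.
Qed.

Lemma horner_shift_poly (x : rat) (p : {poly rat}) (y : rat) :
  (p \Po shift_poly x).[y] = p.[y + x].
Proof. by rewrite horner_comp !hornerE. Qed.

Lemma natr_shift (m q c : nat) : (2 * m <= q)%N ->
  (q + c - 2 * m)%:R = q%:R + (c%:R - 2 * m%:R) :> rat.
Proof. by move=> h; rewrite natrB ?natrD ?natrM; [ring | lia]. Qed.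

Lemma deletionD_polynomial (m : nat) (eps b : bool) (i j : 'I_m) : (i < j)%N ->
  char_quasipoly_is_polynomial (shiD m `\ hyp_of (shi_eq eps b i j))%fset <->
  new_polyD i j eps b false = new_polyD i j eps b true.
Proof.
move=> ij; have m0 : (0 < m)%N by have := ltn_ord i; lia.
pose P odd := (shift_poly (2 - 2 * m%:R)) ^+ m +
  (new_polyD i j eps b odd \Po shift_poly (4 - 2 * m%:R)).
have cP q : (2 * m + 4 <= q)%N ->
    #|arr_complement (shiD m `\ hyp_of (shi_eq eps b i j))%fset q|%:R =
    (if odd q then P true else P false).[q%:R].
  move=> hq; rewrite card_deletion; last by apply/shiDP; exists i, j, eps, b.
  rewrite natrD card_complementD // natrX card_new_pointsD // !natr_shift; [|lia|lia].
  have -> : (if odd q then P true else P false) = P (odd q) by case: (odd q).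
  rewrite /P; cbv beta; rewrite hornerD horner_shift_poly horner_exp.
  by congr (_ + _); rewrite !hornerE.
apply: iff_trans (is_polynomial_iff cP) _; rewrite /P; split=> [/addrI/comp_shift_poly_inj //|->].
by [].
Qed.

Lemma deletionC_polynomial (m : nat) (eps b : bool) (i j : 'I_m) : (i < j)%N ->
  char_quasipoly_is_polynomial (shiC m `\ hyp_of (shi_eq eps b i j))%fset <->
  new_polyC i j eps b false = new_polyC i j eps b true.
Proof.
move=> ij; have m0 : (0 < m)%N by have := ltn_ord i; lia.
pose P odd := (shift_poly (0 - 2 * m%:R)) ^+ m +
  (new_polyC i j eps b odd \Po shift_poly (2 - 2 * m%:R)).
have cP q : (2 * m + 6 <= q)%N ->
    #|arr_complement (shiC m `\ hyp_of (shi_eq eps b i j))%fset q|%:R =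
    (if odd q then P true else P false).[q%:R].
  move=> hq; rewrite card_deletion; last first.
    by apply/shiCP; right; apply/shiDP; exists i, j, eps, b.
  rewrite natrD card_complementC // natrX card_new_pointsC //.
  rewrite -[in LHS](addn0 q) natr_shift ?addn0; last lia.
  rewrite natr_shift; last lia.
  have -> : (if odd q then P true else P false) = P (odd q) by case: (odd q).
  rewrite /P; cbv beta; rewrite hornerD horner_shift_poly horner_exp.
  by congr (_ + _); rewrite !hornerE.
apply: iff_trans (is_polynomial_iff cP) _; rewrite /P; split=> [/addrI/comp_shift_poly_inj //|->].
by [].
Qed.

Lemma horner3_others_poly_gt0 (m : nat) (i j : 'I_m) (phi : 'I_m -> nat) :
  (forall l : 'I_m, l <> i :> nat -> l <> j :> nat -> (phi l <= 2)%N) ->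
  0 < (others_poly i j phi).[3].
Proof.
move=> le2; rewrite horner_others_poly; apply: prodr_gt0 => l /andP[/eqP li /eqP lj].
have : (phi l <= 2)%N by apply: le2 => /val_inj.
by rewrite subr_gt0 (ltr_nat _ _ 3).
Qed.

(** At 3 all factors are positive, so one strictly larger factor decides. *)
Lemma others_poly_neq (m : nat) (i j l0 : 'I_m) (phi psi : 'I_m -> nat) :
    l0 <> i :> nat -> l0 <> j :> nat -> (phi l0 < psi l0)%N ->
    (forall l : 'I_m, l <> i :> nat -> l <> j :> nat -> (phi l <= psi l <= 2)%N) ->
  others_poly i j phi <> others_poly i j psi.
Proof.
move=> l0i l0j lt le e; have := congr1 (fun p : {poly rat} => p.[3]) e.
apply/eqP; rewrite gt_eqF // !horner_others_poly.
have l0P : (l0 != i) && (l0 != j) by rewrite -!val_eqE /=; lia.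
have le' l : (l != i) && (l != j) -> (phi l <= psi l <= 2)%N.
  by rewrite -!val_eqE /= => /andP[/eqP li /eqP lj]; apply: le.
rewrite (bigD1 l0) //= [X in _ < X](bigD1 l0) //=.
have pos : 0 < \prod_(l | (l != i) && (l != j) && (l != l0)) (3 - (psi l)%:R : rat).
  apply: prodr_gt0 => l /andP[/le' h _].
  by rewrite subr_gt0 (ltr_nat _ _ 3); lia.
apply: (@lt_le_trans _ _ ((3 - (phi l0)%:R) *
    \prod_(l | (l != i) && (l != j) && (l != l0)) (3 - (psi l)%:R : rat))).
  by rewrite ltr_pM2r // ltrD2l ltrN2 ltr_nat.
apply: ler_wpM2l; first by rewrite subr_ge0 (ler_nat _ _ 3); have := le' _ l0P; lia.
apply: ler_prod => l /andP[/le' h _]; apply/andP; split.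
  by rewrite subr_ge0 (ler_nat _ _ 3); lia.
by rewrite lerD2l lerN2 ler_nat; lia.
Qed.

(** At 2 a factor is 1 if its label is above i and 2 otherwise, so the value tells
    how many labels are below i. *)
Lemma horner2_others_poly_above (m : nat) (i j : 'I_m) : (i < j)%N ->
  (others_poly i j (fun l => i < l)%N).[2] = 2 ^+ i.
Proof.
move=> ij; have im := ltn_ord i; rewrite horner_others_poly big_mkcond /=.
have -> : (2 : rat) ^+ i = \prod_(l < i) 2 by rewrite prodr_const card_ord.
rewrite (big_ord_widen m (fun _ => 2 : rat) (ltnW im)) [RHS]big_mkcond /=.
apply: eq_bigr => l _; rewrite -!val_eqE /=.
by case: (ltngtP l i) => //= li; [rewrite subr0; case: ltngtP => //; lia | case: ifP => // _; ring].
Qed.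

Lemma others_poly_rev (m : nat) (i j : 'I_m) :
  others_poly i j (fun l => l < j)%N = others_poly (rev_ord i) (rev_ord j) (fun l => rev_ord j < l)%N.
Proof.
rewrite /others_poly (reindex_inj rev_ord_inj) /=; apply: eq_big => l.
  by rewrite !(can2_eq rev_ordK rev_ordK).
move=> _; congr ('X - _%:R%:P); have := ltn_ord l; have := ltn_ord j; lia.
Qed.

(** In each case the difference of the two polynomials reduces to the difference of
    two products. For x_i - x_j = 0 they count the labels above i and the
    labels below j, which are equally many exactly when j = m + 1 - i. *)
Lemma new_polyD_parity (m : nat) (eps b : bool) (i j : 'I_m) : (i < j)%N ->
  new_polyD i j eps b false = new_polyD i j eps b true <->
  match eps, b with
  | false, false => j = rev_ord i
  | false, true => True
  | true, false => i = 0%N :> nat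
  | true, true => j = m.-1 :> nat
  end.
Proof.
move=> ij; have im := ltn_ord i; have jm := ltn_ord j.
case: eps; case: b; rewrite /new_polyD.
- set p := others_poly i j (fun l => (l < i) + (l < j))%N;
  set r := others_poly i j (fun l => 1 + (l < i))%N.
  have -> : ('X * p - 2%:P * r = ('X - 1%:P) * p - r) <-> p = r.
    split=> [e|->]; last by rewrite mulrBl; ring.
    apply/eqP; rewrite -subr_eq0.
    have -> : p - r = ('X * p - 2%:P * r) - (('X - 1%:P) * p - r) by ring.
    by rewrite e subrr.
  split=> [e|e].
    have [//|jl] : j = m.-1 :> nat \/ (j < m.-1)%N by lia.
    have lm : (m.-1 < m)%N by lia.
    exfalso; move: e; apply: (@others_poly_neq _ _ _ (Ordinal lm)) => [/=|/=|/=|l li lj]; lia.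
  by apply: eq_others_poly => l li lj; have := ltn_ord l; lia.
- set p := others_poly i j (fun l => (i < l) + (j < l))%N.
  set r := others_poly i j (fun l => (i < l) + (j < l) + (l < i))%N.
  have -> : (('X - 2%:P) * p = ('X - 1%:P) * p - r) <-> p = r.
    split=> [e|->]; last by ring.
    apply/eqP; rewrite -subr_eq0.
    have -> : p - r = (('X - 1%:P) * p - r) - ('X - 2%:P) * p by ring.
    by rewrite e subrr.
  split=> [e|e].
    have [//|i0] := posnP i.
    have lm : (0 < m)%N by lia.
    exfalso; move: e; apply: (@others_poly_neq _ _ _ (Ordinal lm)) => [/=|/=|/=|l li lj]; lia.
  by apply: eq_others_poly => l li lj; lia.
- by [].
- split=> [/addrI/oppr_inj e|e]; last first.
    congr (_ - _); rewrite others_poly_rev e rev_ordK others_polyC.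
    by rewrite -e; apply: eq_others_poly => l; rewrite e /=; lia.
  have := congr1 (fun p : {poly rat} => p.[2]) e.
  rewrite /= horner2_others_poly_above // others_poly_rev others_polyC horner2_others_poly_above;
    last by move=> /=; lia.
  rewrite -!natrX => /eqP; rewrite eqr_nat eqn_exp2l //= => /eqP e2.
  by apply: val_inj => /=; lia.
Qed.

Lemma new_polyC_parity (m : nat) (eps b : bool) (i j : 'I_m) : (i < j)%N ->
  new_polyC i j eps b false = new_polyC i j eps b true <-> eps = false.
Proof.
move=> ij; case: eps; case: b; rewrite /new_polyC; split=> // e; exfalso.
  have le (l : 'I_m) : ((l < i) + (l < j) <= 2)%N by lia.
  have := @horner3_others_poly_gt0 m i j _ (fun l _ _ => le l).
  have := congr1 (fun p : {poly rat} => p.[3]) e; rewrite /= !hornerM !hornerE.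
  by move: (others_poly i j _).[3] => x; lra.
have le (l : 'I_m) : ((i < l) + (j < l) <= 2)%N by lia.
have := @horner3_others_poly_gt0 m i j _ (fun l _ _ => le l).
have := congr1 (fun p : {poly rat} => p.[3]) e; rewrite /= !hornerM !hornerE.
by move: (others_poly i j _).[3] => x; lra.
Qed.

(** The number of points is a polynomial plus a count that vanishes for one parity
    of q and is positive for the other. *)
Lemma deletion_diag_not_polynomial (m : nat) (b : bool) (i : 'I_m) :
  ~ char_quasipoly_is_polynomial (shiC m `\ hyp_of (diag_eq b i))%fset.
Proof.
have m0 : (0 < m)%N by have := ltn_ord i; lia.
pose new q := new_points q (shiC m) (hyp_of (diag_eq b i)).
have cN q : (8 * m + 8 <= q)%N ->
    #|arr_complement (shiC m `\ hyp_of (diag_eq b i))%fset q|%:R =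
    (shift_poly (0 - 2 * m%:R) ^+ m).[q%:R] + #|new q|%:R.
  move=> hq; rewrite card_deletion; last by apply/shiCP; left; exists i, b.
  rewrite natrD card_complementC //; last lia.
  rewrite natrX -[in LHS](addn0 q) natr_shift ?addn0; last lia.
  by rewrite horner_exp !hornerE.
case: b @new cN => new cN.
  apply: (not_polynomial (b := false) cN) => q hq oq.
    by apply: new_points_diag_none => //; lia.
  apply: (leq_trans (@new_points_diag_exist m q true i hq oq)).
  by apply: subset_leq_card; apply: subsetIl.
pose E q := #|(new q :&: off_zero q i)%SET|.
pose G : {poly rat} := \prod_(l : 'I_m | l != i) ('X + (1 - 2 * m%:R - (i < l)%:R)%:P).
apply: (@not_polynomial m _ (shift_poly (0 - 2 * m%:R) ^+ m + G) E true (8 * m + 8)).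
- move=> q hq; rewrite cN // -(cardsID (off_zero q i) (new q)) natrD hornerD -addrA.
  congr (_ + _); rewrite addrC; congr (_ + _).
  rewrite card_new_points_zero; last lia.
  rewrite natr_prod horner_prod; apply: eq_bigr => l _; rewrite hornerD hornerX hornerC.
  by rewrite natrB ?natr_shift; [ring | lia | case: (i < l)%N; lia].
- by move=> q hq oq; apply: new_points_zero_odd => //; lia.
- by move=> q hq oq; apply: new_points_diag_exist.
Qed.

Lemma hyp_ofN (m : nat) (e : equation m) : hyp_of (- e) = hyp_of e.
Proof.
by apply/eqP; rewrite /hyp_of /hyp eqmodE /=; apply/orP; right; case: e.
Qed.

Local Open Scope fset_scope.

(* Coordinates are numbered from 0: the indices 1 and m of the text are 0 and
   m.-1, and m + 1 - i is rev_ord i. *)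
Theorem corollary1p8 (m : nat) (m_gt0 : (0 < m)%N) :
  (forall H : hyperplane m, H \in shiC m ->
     (char_quasipoly_is_polynomial (shiC m `\ H) <->
        (exists i j : 'I_m, (i < j)%N /\ H = hyp (xcoord i - xcoord j) 0)
        \/ (exists i j : 'I_m, (i < j)%N /\ H = hyp (xcoord i - xcoord j) 1)))
  /\
  (forall H : hyperplane m, H \in shiD m ->
     (char_quasipoly_is_polynomial (shiD m `\ H) <->
        [\/ exists i : 'I_m, H = hyp (xcoord i - xcoord (rev_ord i)) 0,
            exists i j : 'I_m, (i < j)%N /\ H = hyp (xcoord i - xcoord j) 1,
            exists i j : 'I_m,
              [/\ i = 0%N :> nat, (1 <= j)%N & H = hyp (xcoord i + xcoord j) 0]
          | exists i j : 'I_m,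
              [/\ (i < m.-1)%N, j = m.-1 :> nat
                & H = hyp (xcoord i + xcoord j) 1]])).
Proof.
have hypE (eps b : bool) (i j : 'I_m) :
    hyp (if eps then xcoord i + xcoord j else xcoord i - xcoord j)%R (b : nat)%:Z =
    hyp_of (shi_eq eps b i j) by [].
split=> H.
  case/shiCP=> [[i [b ->]]|/shiDP[i [j [eps [b [ij ->]]]]]].
    split=> [/deletion_diag_not_polynomial //|].
    case=> -[k [l [kl e]]]; exfalso.
      by apply: (hyp_shi_diag (eps := false) (b := false) kl); rewrite -hypE -e.
    by apply: (hyp_shi_diag (eps := false) (b := true) kl); rewrite -hypE -e.
  apply: iff_trans (deletionC_polynomial eps b ij) _.
  apply: iff_trans (new_polyC_parity eps b ij) _; split=> [->|].
    by case: b; [right|left]; exists i, j.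
  case=> -[k [l [kl e]]].
    by case: (@hyp_shi_inj m eps b false false i j k l ij kl e).
  by case: (@hyp_shi_inj m eps b false true i j k l ij kl e).
case/shiDP=> [i [j [eps [b [ij ->]]]]].
apply: iff_trans (deletionD_polynomial eps b ij) _.
apply: iff_trans (new_polyD_parity eps b ij) _.
have im := ltn_ord i; have jm := ltn_ord j.
split.
  case: eps; case: b => h.
  - by apply: Or44; exists i, j; split=> //; lia.
  - by apply: Or43; exists i, j; split=> //; lia.
  - by apply: Or42; exists i, j.
  - by apply: Or41; exists i; rewrite -h.
case.
- case=> k e; have [lt|lt|/val_inj ek] := ltngtP k (rev_ord k).
  + by case: (@hyp_shi_inj m eps b false false i j k _ ij lt e) => -> -> -> ->.
  + have e2 : hyp_of (shi_eq false false k (rev_ord k)) = hyp_of (shi_eq false false (rev_ord k) k).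
      by rewrite -hyp_ofN; congr hyp_of; congr pair; rewrite /= ?opprB ?oppr0.
    case: (@hyp_shi_inj m eps b false false i j _ k ij lt (etrans e e2)) => -> -> -> ->.
    by rewrite rev_ordK.
  + exfalso; move: e; rewrite -ek subrr.
    move/(@hyp_of_inj m (shi_eq eps b i j) (0, 0))=> [s [_ /(_ i) + _]].
    rewrite shi_eqE mxE mulr0 eqxx -val_eqE /=.
    have -> : (i == j :> nat) = false by lia.
    by rewrite mulr0 addr0.
- case=> k [l [kl e]].
  by case: (@hyp_shi_inj m eps b false true i j k l ij kl e) => _ _ -> ->.
- case=> k [l [k0 l1 e]]; have kl : (k < l)%N by rewrite k0.
  by case: (@hyp_shi_inj m eps b true false i j k l ij kl e) => -> _ -> ->.
- case=> k [l [km lm e]]; have kl : (k < l)%N by rewrite lm.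
  by case: (@hyp_shi_inj m eps b true true i j k l ij kl e) => _ -> -> ->.
Qed.
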